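(* Let $\Sigma^1J^2(3,5)$ be the set of $2$-jets at $0$ of corank $1$ smooth map germs $(\mathbb{R}^3,0)\to(\mathbb{R}^5,0)$. Under the action of $\mathcal{A}^2$ ($2$-jets of diffeomorphism germs in source and target) there exist exactly six orbits in $\Sigma^1J^2(3,5)$, namely the orbits of $$(x,y,xz,yz,z^2),\quad (x,y,z^2,xz,0),\quad (x,y,xz,yz,0),\quad (x,y,z^2,0,0),\quad (x,y,xz,0,0),\quad (x,y,0,0,0).$$
   Context: $J^2(3,5)$ denotes the space of $2$-jets $j^2f(0)$ (Taylor polynomials of degree $\le 2$ at $0$, without constant term) of smooth map germs $f:(\mathbb{R}^3,0)\to(\mathbb{R}^5,0)$, and $\Sigma^1J^2(3,5)\subset J^2(3,5)$ is the subset of $2$-jets of corank $1$, i.e. those for which the differential $df_0:\mathbb{R}^3\to\mathbb{R}^5$ has rank $2$. The group $\mathcal{A}^2$ is the group of pairs of $2$-jets at $0$ of diffeomorphism germs $\psi:(\mathbb{R}^3,0)\to(\mathbb{R}^3,0)$ (source) and $\Phi:(\mathbb{R}^5,0)\to(\mathbb{R}^5,0)$ (target). It acts on $2$-jets by changes of coordinates: $j^2f(0)$ and $j^2g(0)$ are in the same orbit iff there are such $\psi,\Phi$ with $j^2(\Phi\circ f\circ\psi)(0)=j^2g(0)$. Coordinates in $\mathbb{R}^3$ are $(x,y,z)$. *)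

(* Defs.v *)
From mathcomp Require Import all_boot all_order all_algebra.
From mathcomp Require Import all_classical all_reals all_analysis.
Set Implicit Arguments.
Unset Strict Implicit.
Unset Printing Implicit Defensive.
Import Order.TTheory GRing.Theory Num.Theory.
Import numFieldNormedType.Exports.
Local Open Scope classical_set_scope.
Local Open Scope ring_scope.

Section jets.
Context {R : realType}.

(* Meaningful for open U only. *)
Fixpoint is_Ck (k : nat) (n p : nat) (U : set 'rV[R]_n)
    (f : 'rV[R]_n -> 'rV[R]_p) : Prop :=
  if k is k'.+1 then
    (forall x, U x -> differentiable f x) /\
    (forall v : 'rV[R]_n, is_Ck k' U (fun x => 'D_v f x))
  else forall x, U x -> {for x, continuous f}.

(* Germs at 0 are handled through their representatives, which are total
   functions constrained only on a neighbourhood of 0; every notion below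
   depends only on the germ. *)
Definition map_germ (n p : nat) : set ('rV[R]_n -> 'rV[R]_p) :=
  [set f : 'rV[R]_n -> 'rV[R]_p | f 0 = 0 /\
    exists2 U : set 'rV[R]_n, open_nbhs (0 : 'rV[R]_n) U & forall k, is_Ck k U f].

Definition diffeo_germ (n : nat) : set ('rV[R]_n -> 'rV[R]_n) :=
  [set phi : 'rV[R]_n -> 'rV[R]_n | map_germ phi /\
    exists2 psi : 'rV[R]_n -> 'rV[R]_n, map_germ psi &
      (\forall x \near (0 : 'rV[R]_n), psi (phi x) = x) /\
      (\forall x \near (0 : 'rV[R]_n), phi (psi x) = x)].

(* The Taylor polynomial of degree <= 2 of f at 0, without its constant term,
   as a polynomial function; delta_mx 0 i is the i-th basis vector. *)
Definition jet2 (n p : nat) (f : 'rV[R]_n -> 'rV[R]_p) :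
    'rV[R]_n -> 'rV[R]_p :=
  fun v =>
    \sum_(i < n) v 0 i *: 'D_(delta_mx 0 i) f 0 +
    2^-1 *: \sum_(i < n) \sum_(j < n) (v 0 i * v 0 j) *:
      'D_(delta_mx 0 i) (fun x => 'D_(delta_mx 0 j) f x) 0.

(* Corank r: the kernel of the differential at 0 has dimension r. *)
Definition SigmaJ2 (r n p : nat) : set ('rV[R]_n -> 'rV[R]_p) :=
  [set jet2 f | f in [set f : 'rV[R]_n -> 'rV[R]_p |
    map_germ f /\ (\rank (jacobian f 0%R) + r = n)%N]].

Definition A2_orbit (n p : nat) (j : 'rV[R]_n -> 'rV[R]_p) :
    set ('rV[R]_n -> 'rV[R]_p) :=
  [set j' | exists (f : 'rV[R]_n -> 'rV[R]_p) (psi : 'rV[R]_n -> 'rV[R]_n)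
      (Phi : 'rV[R]_p -> 'rV[R]_p),
    [/\ map_germ f, jet2 f = j, diffeo_germ psi, diffeo_germ Phi &
        jet2 (Phi \o f \o psi) = j']].

Definition map35 (F : R -> R -> R -> seq R) : 'rV[R]_3 -> 'rV[R]_5 :=
  fun v => \row_(i < 5) (F (v 0 0) (v 0 1) (v 0 2))`_i.

End jets.

(* Main.v *)
From HB Require Import structures.
Require Import Defs.
From mathcomp Require Import all_boot all_order all_algebra.
From mathcomp Require Import all_classical all_reals all_analysis.
From mathcomp Require Import ring lra.
Set Implicit Arguments.
Unset Strict Implicit.
Unset Printing Implicit Defensive.
Import Order.TTheory GRing.Theory Num.Theory.
Import numFieldNormedType.Exports.
Local Open Scope classical_set_scope.
Local Open Scope ring_scope.

(** Why there are exactly six orbits.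

    The 2-jet of a germ is a pair (A, q): the Jacobian matrix A at 0, acting on
    row vectors, and a quadratic map q. By the chain rule, the 2-jet of a
    composite depends only on the 2-jets of its factors ([jacobian_comp],
    [quad_part_comp]). Hence changing coordinates by psi and Phi with 2-jets
    (M, r) and (L, s) replaces (A, q) by
      ( M A L,  v |-> (r(v) A + q(v M)) L + s(v M A) ).
    Conversely, in dimension at least 2, every pair (L, s) with L invertible
    and s quadratic is the 2-jet of a diffeomorphism germ ([diffeo_jet]): the
    quadratic parts of the diffeomorphism germs tangent to the identity are
    closed under addition, since composition adds them, and they include those
    of the explicit maps
      x |-> x + a(x) (exp b(x) - 1) w,   a(w) = 1, b(w) = 0,
    which are inverted by changing the sign of b. Sums of these exhaust all
    quadratic maps. So the classification is a problem of linear algebra.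

    A jet of corank 1 can be brought to A = (x, y, z) |-> (x, y, 0, 0, 0). The
    target quadratic s then removes from q everything that depends on x, y
    only, and the source quadratic r removes the first two components. What is
    left is z (x, y, z) C in the last three components, for a 3 x 3 matrix C
    ([SigmaJ2_nf]). Linear changes in the last three target coordinates
    multiply C on the right by any invertible matrix; a source change
    z |-> z + l(x, y) together with a linear change of x, y mixes the two upper
    rows of C and adds multiples of the last row to them. Gaussian elimination
    brings C to one of six matrices ([nf_canon]), according to whether its last
    row vanishes and to its rank.

    Those two data are invariants ([A2_orbit_nf_le]): polarizing q in the
    direction of the kernel of A, modulo the image of A, gives the intrinsic
    second derivative, which cancels the contributions of r and s, and whose
    matrix is C with its last row doubled. *)

(** * Closure properties of differentiability classes *)

(** The differential depends only on the germ: the affine approximation of [f]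
    at [a] is also one of [g]. *)
Lemma near_eq_differentiable (K : numFieldType) (V W : normedModType K)
    (f g : V -> W) (a : V) :
  {near a, f =1 g} -> differentiable f a -> differentiable g a.
Proof.
move=> fg df.
have fga : f a = g a := nbhs_singleton fg.
have step : g \o shift a = cst (g a) + ('d f a : V -> W) +o_ (0 : V) id.
  apply/eqaddoP => e e0.
  have /eqaddoP/(_ e e0) de := diff_locally df.
  have fg0 : \forall x \near (0 : V), f (x + a) = g (x + a).
    have := fg; rewrite (near_shift 0 a) /=.
    by apply: filterS => x; rewrite /= subr0.
  apply: filterS2 de fg0 => x; rewrite /= !fctE /= => H E; rewrite -fga -E; exact: H.
have dg : 'd g a = 'd f a :> (V -> W).
  apply: (@diff_unique _ _ _ _ (@diff _ _ _ _ (Phantom _ (nbhs a)) f)).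
    exact: diff_continuous.
  exact: step.
by apply/diff_locallyP; rewrite dg; split => //; apply: diff_continuous.
Qed.

Section Ck.
Context {R : realType}.

(** The recursion of [is_Ck], with an arbitrary normed codomain: products and
    composition are handled on scalar functions, one coordinate at a time. *)
Fixpoint Ck (W : normedModType R) (k n : nat) (U : set 'rV[R]_n)
    (f : 'rV[R]_n -> W) : Prop :=
  if k is k'.+1 then
    (forall x, U x -> differentiable f x) /\
    (forall v : 'rV[R]_n, Ck k' U (fun x => 'D_v f x))
  else forall x, U x -> {for x, continuous f}.

Lemma is_CkE k n p (U : set 'rV[R]_n) (f : 'rV[R]_n -> 'rV[R]_p) :
  is_Ck k U f <-> Ck k U f.
Proof.
elim: k f => //= k IH f; split=> -[df Df]; split=> // v; exact/IH/Df.
Qed.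

Lemma CkS (W : normedModType R) k n (U : set 'rV[R]_n) (f : 'rV[R]_n -> W) :
  Ck k.+1 U f -> Ck k U f.
Proof.
elim: k f => [|k IH] f [df Df].
  by move=> x Ux; exact/differentiable_continuous/df.
by split=> // v; exact/IH/Df.
Qed.

Lemma Ck_sub (W : normedModType R) k n (U V : set 'rV[R]_n)
    (f : 'rV[R]_n -> W) : V `<=` U -> Ck k U f -> Ck k V f.
Proof.
move=> VU; elim: k f => [|k IH] f /=; first by move=> cf x /VU; exact: cf.
by move=> [df Df]; split=> [x /VU/df//|v]; exact/IH/Df.
Qed.

Lemma near_eq_on_open (W : Type) n (U : set 'rV[R]_n) (f g : 'rV[R]_n -> W) x :
  open U -> (forall x, U x -> f x = g x) -> U x -> \forall y \near x, f y = g y.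
Proof.
move=> oU fg Ux.
by apply: filterS (open_nbhs_nbhs (conj oU Ux : open_nbhs x U)) => y /fg.
Qed.

(** Every later closure property computes a derivative only at the points of
    [U], while [Ck] mentions the derivative as a total function; openness of
    [U] bridges the two. *)
Lemma Ck_ext (W : normedModType R) k n (U : set 'rV[R]_n)
    (f g : 'rV[R]_n -> W) : open U -> (forall x, U x -> f x = g x) ->
  Ck k U f -> Ck k U g.
Proof.
move=> oU; elim: k f g => [|k IH] f g fg /=.
  move=> cf x Ux; rewrite /prop_for/continuous_at -fg//.
  apply: cvg_trans (cf x Ux); apply: (@near_eq_cvg _ _ (nbhs x)).
  exact: near_eq_on_open Ux.
move=> [df Df]; split=> [x Ux|v].
  exact: near_eq_differentiable (near_eq_on_open oU fg Ux) (df x Ux).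
apply: IH (Df v) => x Ux; exact: near_eq_derive (near_eq_on_open oU fg Ux).
Qed.

Lemma Ck_cst (W : normedModType R) k n (U : set 'rV[R]_n) (w : W) :
  Ck k U (fun _ : 'rV[R]_n => w).
Proof.
elim: k w => [|k IH] w /=; first by move=> x _; exact: cst_continuous.
split=> [x _|v]; first exact: differentiable_cst.
suff -> : 'D_v (fun _ : 'rV[R]_n => w) = (fun=> 0) by exact: IH.
by apply/funext => x; exact: derive_cst.
Qed.

Lemma Ck_lin_comp (W W' : normedModType R) k n (U : set 'rV[R]_n)
    (L : {linear W -> W'}) (f : 'rV[R]_n -> W) :
  open U -> continuous L -> Ck k U f -> Ck k U (L \o f).
Proof.
move=> oU cL; elim: k f => [|k IH] f /=.
  by move=> cf x Ux; apply: continuous_comp; [exact: cf|exact: cL].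
move=> [df Df]; split=> [x Ux|v].
  by apply: differentiable_comp; [exact: df|exact: linear_differentiable].
apply: (Ck_ext oU _ (IH _ (Df v))) => x Ux /=.
have dL y : differentiable L y by exact: linear_differentiable.
rewrite deriveE; last exact: df.
rewrite [RHS]deriveE; last by apply: differentiable_comp => //; exact: df.
by rewrite (diff_comp (df x Ux) (dL _)) /= diff_lin.
Qed.

Lemma Ck_linear_comp (W W' : normedModType R) k n (U : set 'rV[R]_n)
    (L : W -> W') (f : 'rV[R]_n -> W) :
  open U -> linear L -> continuous L -> Ck k U f -> Ck k U (fun x => L (f x)).
Proof.
move=> oU linL cL; pose L' : {linear W -> W'} :=
  HB.pack L (GRing.isLinear.Build _ _ _ _ _ linL).
exact: (@Ck_lin_comp _ _ _ _ _ L').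
Qed.

Lemma CkD (W : normedModType R) k n (U : set 'rV[R]_n)
    (f g : 'rV[R]_n -> W) : open U -> Ck k U f -> Ck k U g ->
  Ck k U (fun x => f x + g x).
Proof.
move=> oU; elim: k f g => [|k IH] f g /=.
  by move=> cf cg x Ux; exact: cvgD (cf x Ux) (cg x Ux).
move=> [df Df] [dg Dg]; split=> [x Ux|v].
  by apply: differentiableD; [exact: df|exact: dg].
apply: (Ck_ext oU _ (IH _ _ (Df v) (Dg v))) => x Ux /=.
by rewrite [RHS]deriveD//; apply: diff_derivable; [exact: df|exact: dg].
Qed.

Lemma Ck_sum (W : normedModType R) k n (U : set 'rV[R]_n) m
    (f : 'I_m -> 'rV[R]_n -> W) : open U -> (forall i, Ck k U (f i)) ->
  Ck k U (fun x => \sum_i f i x).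
Proof.
move=> oU Cf.
suff H (s : seq 'I_m) : Ck k U (fun x => \sum_(i <- s) f i x) by exact: H.
elim: s => [|i s IH].
  by under eq_fun do rewrite big_nil; exact: Ck_cst.
by under eq_fun do rewrite big_cons; exact: CkD.
Qed.

Lemma CkM k n (U : set 'rV[R]_n) (f g : 'rV[R]_n -> R) : open U ->
  Ck k U f -> Ck k U g -> Ck k U (fun x => f x * g x).
Proof.
move=> oU; elim: k f g => [|k IH] f g.
  by move=> cf cg x Ux; exact: cvgM (cf x Ux) (cg x Ux).
move=> Cf Cg; have [df Df] := Cf; have [dg Dg] := Cg; split=> [x Ux|v].
  by apply: differentiableM; [exact: df|exact: dg].
apply: (Ck_ext oU _ (CkD oU (IH _ _ (CkS Cf) (Dg v)) (IH _ _ (CkS Cg) (Df v)))).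
move=> x Ux /=.
by rewrite [RHS]deriveM//; apply: diff_derivable; [exact: df|exact: dg].
Qed.

Lemma Ck_coord k n p (U : set 'rV[R]_n) (f : 'rV[R]_n -> 'rV[R]_p) :
  open U -> Ck k U f <-> forall i, Ck k U (fun x => f x 0 i : R).
Proof.
move=> oU; split=> [Cf i|Cf].
  apply: (Ck_linear_comp (L := fun N : 'rV[R]_p => N 0 i : R) oU) => //.
    by move=> a u v; rewrite !mxE.
  exact: coord_continuous.
apply: (Ck_ext oU (f := fun x => \sum_i f x 0 i *: delta_mx 0 i)).
  by move=> x _; rewrite -row_sum_delta.
apply: Ck_sum => // i.
apply: (Ck_linear_comp (L := fun a : R => a *: delta_mx 0 i) oU) => //.
  by move=> a u v; rewrite scalerDl scalerA.
exact: scalel_continuous.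
Qed.

Lemma derive_comp n p (W : normedModType R) (f : 'rV[R]_n -> 'rV[R]_p)
    (g : 'rV[R]_p -> W) (x v : 'rV[R]_n) :
  differentiable f x -> differentiable g (f x) ->
  'D_v (g \o f) x = \sum_i ('D_v f x) 0 i *: 'D_(delta_mx 0 i) g (f x).
Proof.
move=> df dg; rewrite deriveE; last exact: differentiable_comp.
rewrite (diff_comp df dg) /= -(deriveE _ df) [X in _ X = _]row_sum_delta linear_sum.
by apply: eq_bigr => i _; rewrite linearZ /= -(deriveE _ dg).
Qed.

(** Induction on [k] through the chain rule: the derivative of [g \o f] is a sum
    of products of coordinates of the derivative of [f] with composites of
    partial derivatives of [g] and [f]. *)
Lemma Ck_comp k n p (U : set 'rV[R]_n) (V : set 'rV[R]_p)
    (f : 'rV[R]_n -> 'rV[R]_p) (g : 'rV[R]_p -> R) :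
  open U -> open V -> (forall x, U x -> V (f x)) ->
  Ck k U f -> Ck k V g -> Ck k U (g \o f).
Proof.
move=> oU oV UV; elim: k g => [|k IH] g.
  by move=> cf cg x Ux; apply: continuous_comp; [exact: cf|exact/cg/UV].
move=> Cf Cg; have [df Df] := Cf; have [dg Dg] := Cg; split=> [x Ux|v].
  by apply: differentiable_comp; [exact: df|exact/dg/UV].
apply: (Ck_ext oU (f := fun x =>
   \sum_i ('D_v f x) 0 i * 'D_(delta_mx 0 i) g (f x))).
  by move=> x Ux; rewrite [RHS]derive_comp//; [exact: df|exact/dg/UV].
apply: Ck_sum => // i; apply: CkM => //.
  by move: i; apply/Ck_coord => //; exact: Df.
exact: IH (CkS Cf) (Dg _).
Qed.

End Ck.

(** * The chain rule up to order two *)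

Section germs.
Context {R : realType}.

Lemma map_germ_comp n p q (f : 'rV[R]_n -> 'rV[R]_p) (g : 'rV[R]_p -> 'rV[R]_q) :
  map_germ f -> map_germ g -> map_germ (g \o f).
Proof.
move=> [f0 [U [oU U0] Cf]] [g0 [V [oV V0] Cg]].
split; first by rewrite /= f0.
pose W := U `&` f @^-1` V.
have cf x : U x -> {for x, continuous f} by move=> Ux; exact: (Cf 0%N).
have oW : open W.
  rewrite openE => x [Ux Vfx]; apply: filterI.
    exact: (open_nbhs_nbhs (conj oU Ux : open_nbhs x U)).
  exact: (cf x Ux _ (open_nbhs_nbhs (conj oV Vfx : open_nbhs (f x) V))).
exists W; first by split=> //; split=> //=; rewrite f0.
move=> k; apply/is_CkE/Ck_coord => // i.
apply: (@Ck_comp _ k n p W V f (fun y => g y 0 i)) => //.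
- by move=> x [].
- by apply: (@Ck_sub _ _ _ _ U); [move=> x []|exact/is_CkE].
- by move: i; apply/Ck_coord => //; exact/is_CkE.
Qed.

Definition hess n p (f : 'rV[R]_n -> 'rV[R]_p) (u v : 'rV[R]_n) :=
  'D_u (fun x => 'D_v f x) 0.

Definition quad_part n p (f : 'rV[R]_n -> 'rV[R]_p) (v : 'rV[R]_n) : 'rV[R]_p :=
  2^-1 *: hess f v v.

Lemma germ_diff n p (f : 'rV[R]_n -> 'rV[R]_p) :
  map_germ f -> \forall x \near 0, differentiable f x.
Proof.
move=> [_ [U oU Cf]]; have [df _] := (is_CkE 1 U f).1 (Cf 1%N).
by apply: filterS (open_nbhs_nbhs oU) => x /df.
Qed.

Lemma germ_diff0 n p (f : 'rV[R]_n -> 'rV[R]_p) :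
  map_germ f -> differentiable f 0.
Proof. by move=> /germ_diff /nbhs_singleton. Qed.

Lemma germ_derive_diff n p (f : 'rV[R]_n -> 'rV[R]_p) v :
  map_germ f -> differentiable (fun x => 'D_v f x) 0.
Proof.
move=> [_ [U oU Cf]]; have [_ /(_ v)[+ _]] := (is_CkE 2 U f).1 (Cf 2%N).
by apply; case: oU.
Qed.

Lemma derive_jacobian0 n p (f : 'rV[R]_n -> 'rV[R]_p) v :
  map_germ f -> 'D_v f 0 = v *m jacobian f 0.
Proof. by move=> /germ_diff0 df; rewrite deriveEjacobian. Qed.

Lemma hess_linearl n p (f : 'rV[R]_n -> 'rV[R]_p) v :
  map_germ f -> linear (fun u => hess f u v).
Proof.
move=> gf a u w; have d := germ_derive_diff v gf.
by rewrite /hess !deriveE// linearP.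
Qed.

Lemma hess_linearr n p (f : 'rV[R]_n -> 'rV[R]_p) u :
  map_germ f -> linear (hess f u).
Proof.
move=> gf a v w; rewrite /hess.
have dv := germ_derive_diff v gf; have dw := germ_derive_diff w gf.
transitivity ('D_u (a *: (fun x => 'D_v f x) + (fun x => 'D_w f x)) 0).
  apply: near_eq_derive; apply: filterS (germ_diff gf) => x df.
  by rewrite !fctE /= !deriveE// linearP.
rewrite deriveD ?deriveZ//; try exact: diff_derivable.
by apply: diff_derivable; exact: differentiableZ.
Qed.

Lemma linear_row_sum n (W : lmodType R) (g : 'rV[R]_n -> W) v : linear g ->
  g v = \sum_i v 0 i *: g (delta_mx 0 i).
Proof.
move=> gl; pose G : {linear 'rV[R]_n -> W} :=
  HB.pack g (GRing.isLinear.Build _ _ _ _ _ gl).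
rewrite -[g]/(G : _ -> _) [in LHS](row_sum_delta v) linear_sum.
by apply: eq_bigr => i _; rewrite linearZ.
Qed.

(** The coordinate sums in [jet2] are the expansions, in the standard basis, of
    the differential and of the bilinear map [hess f]. *)
Lemma jet2E n p (f : 'rV[R]_n -> 'rV[R]_p) v :
  map_germ f -> jet2 f v = v *m jacobian f 0 + quad_part f v.
Proof.
move=> gf; rewrite /jet2 /quad_part; congr (_ + 2^-1 *: _).
  rewrite [v in RHS]row_sum_delta mulmx_suml; apply: eq_bigr => i _.
  by rewrite -scalemxAl derive_jacobian0.
rewrite (linear_row_sum v (hess_linearl v gf)); apply: eq_bigr => i _.
rewrite (linear_row_sum v (hess_linearr _ gf)) scaler_sumr.
by apply: eq_bigr => j _; rewrite scalerA.
Qed.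

Lemma jacobian_comp n p q (f : 'rV[R]_n -> 'rV[R]_p) (g : 'rV[R]_p -> 'rV[R]_q) :
  map_germ f -> map_germ g ->
  jacobian (g \o f) 0 = jacobian f 0 *m jacobian g 0.
Proof.
move=> gf gg; have f0 : f 0 = 0 by case: gf.
have df := germ_diff0 gf; have dg := germ_diff0 gg.
rewrite -f0 in dg.
apply/row_matrixP => i; rewrite !rowE mulmxA.
rewrite -derive_jacobian0; last exact: map_germ_comp.
rewrite deriveE; last exact: differentiable_comp.
rewrite (diff_comp df dg) /= f0 -(deriveE _ df).
by rewrite -deriveE -?derive_jacobian0// -f0.
Qed.

Lemma derive_scale n p (a : 'rV[R]_n -> R) (G : 'rV[R]_n -> 'rV[R]_p) x v :
  derivable a x v -> derivable G x v ->
  derivable (fun x => a x *: G x) x v /\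
  'D_v (fun x => a x *: G x) x = 'D_v a x *: G x + a x *: 'D_v G x.
Proof.
move=> da dG; have dGi i j : derivable (fun x => G x i j) x v.
  by move: i j; apply/derivable_mxP.
have E i j : (fun x => (a x *: G x) i j) = a * (fun x => G x i j).
  by apply/funext => y; rewrite mxE.
have daG : derivable (fun x => a x *: G x) x v.
  by apply/derivable_mxP => i j; rewrite E; exact: (derivableM da (dGi i j)).
split=> //; rewrite (derive_mx daG) (derive_mx dG); apply/matrixP => i j.
rewrite !mxE E (deriveM da (dGi i j)) /=.
by rewrite addrC; congr (_ + _); rewrite mulrC.
Qed.

(** Second-order chain rule on the diagonal. Near 0 the derivative of [g \o f]
    along [v] is the sum over i of ('D_v f)_i ('D_(e_i) g \o f); the product rule
    at 0 gives one term where ['D_v f] is differentiated again and one where the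
    partial derivatives of [g] are differentiated along ['D_v f 0]. *)
Lemma quad_part_comp n p q (f : 'rV[R]_n -> 'rV[R]_p) (g : 'rV[R]_p -> 'rV[R]_q) v :
  map_germ f -> map_germ g ->
  quad_part (g \o f) v =
    quad_part f v *m jacobian g 0 + quad_part g (v *m jacobian f 0).
Proof.
move=> gf gg; have f0 : f 0 = 0 by case: gf.
have df := germ_diff0 gf; have dg := germ_diff0 gg.
rewrite /quad_part -scalemxAl -scalerDr; congr (_ *: _).
have gDi i := germ_derive_diff (delta_mx 0 i) gg.
have fD := germ_derive_diff v gf.
rewrite -(derive_jacobian0 v gf).
pose F x := \sum_i ('D_v f x) 0 i *: 'D_(delta_mx 0 i) g (f x).
have nF : \forall x \near (0 : 'rV[R]_n), 'D_v (g \o f) x = F x.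
  have cf : {for 0, continuous f} by exact: differentiable_continuous.
  have dgf : \forall x \near (0 : 'rV[R]_n), differentiable g (f x).
    by apply: (cf [set y | differentiable g y]); rewrite f0; exact: germ_diff.
  by apply: filterS2 (germ_diff gf) dgf => x dfx dgx; exact: derive_comp.
have dG i : differentiable ('D_(delta_mx 0 i) g \o f) 0.
  by apply: differentiable_comp => //; rewrite f0.
have dS i : derivable (fun x => ('D_v f x) 0 i : R) 0 v.
  by apply: (derivable_mxP _ _ _).1; exact: diff_derivable.
have dGv i : derivable (fun x => 'D_(delta_mx 0 i) g (f x)) 0 v.
  exact: (diff_derivable (dG i)).
have dsc i := derive_scale (dS i) (dGv i).
have sum_fE m (h : 'I_m -> 'rV[R]_n -> 'rV[R]_q) :
    (fun x => \sum_i h i x) = \sum_i h i.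
  by apply/funext => x; rewrite fct_sumE.
have -> : hess f v v *m jacobian g 0 =
    \sum_i (hess f v v) 0 i *: 'D_(delta_mx 0 i) g 0.
  rewrite [X in X *m _]row_sum_delta mulmx_suml; apply: eq_bigr => i _.
  by rewrite -scalemxAl (derive_jacobian0 _ gg).
rewrite (linear_row_sum _ (hess_linearr _ gg)) -big_split /=.
rewrite [LHS](near_eq_derive _ nF) /F sum_fE derive_sum; last first.
  by move=> i; exact: (dsc i).1.
apply: eq_bigr => i _.
have -> : hess f v v 0 i = 'D_v (fun x => ('D_v f x) 0 i : R) 0.
  by rewrite /hess (derive_mx (diff_derivable fD)) mxE.
have E2 : 'D_v ('D_(delta_mx 0 i) g \o f) 0 = hess g ('D_v f 0) (delta_mx 0 i).
  have dGf : differentiable ('D_(delta_mx 0 i) g) (f 0) by rewrite f0.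
  rewrite (deriveE _ (dG i)) (diff_comp df dGf) /= /hess.
  by rewrite (deriveE _ (gDi i)) (deriveE _ df) f0.
by rewrite -E2 (dsc i).2 [in 'D_(delta_mx 0 i) g (f 0)]f0.
Qed.
End germs.

(** * Two-jets as pairs of a matrix and a quadratic map *)

Lemma linear_fZ (R : pzRingType) (U V : lmodType R) (f : U -> V) a u :
  linear f -> f (a *: u) = a *: f u.
Proof.
move=> fl; pose F : {linear U -> V} :=
  HB.pack f (GRing.isLinear.Build _ _ _ _ _ fl).
by rewrite -[f]/(F : _ -> _) linearZ.
Qed.

Lemma linear_fD (R : pzRingType) (U V : lmodType R) (f : U -> V) u v :
  linear f -> f (u + v) = f u + f v.
Proof. by move=> fl; have := fl 1 u v; rewrite !scale1r. Qed.

Section quadratic.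
Context {R : realType}.

Definition bilin n p (b : 'rV[R]_n -> 'rV[R]_n -> 'rV[R]_p) :=
  (forall v, linear (b^~ v)) /\ (forall u, linear (b u)).

(** Any bilinear map is allowed, symmetric or not, so that half the second
    derivative qualifies as it stands. *)
Definition quadratic n p (q : 'rV[R]_n -> 'rV[R]_p) :=
  exists2 b, bilin b & forall v, q v = b v v.

Definition jet n p (A : 'M[R]_(n, p)) (q : 'rV[R]_n -> 'rV[R]_p) v := v *m A + q v.

Lemma quadraticZ n p (q : 'rV[R]_n -> 'rV[R]_p) a v :
  quadratic q -> q (a *: v) = a ^+ 2 *: q v.
Proof.
move=> [b [bl br] qE]; rewrite !qE (linear_fZ _ _ (bl _)) (linear_fZ _ _ (br _)).
by rewrite scalerA expr2.
Qed.

Lemma quadratic_comp n m p (M : 'M[R]_(n, m)) (q : 'rV[R]_m -> 'rV[R]_p) :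
  quadratic q -> quadratic (fun v => q (v *m M)).
Proof.
move=> [b [bl br] qE]; exists (fun u v => b (u *m M) (v *m M)) => [|v].
  by split=> v a u w; rewrite mulmxDl -scalemxAl; [exact: bl|exact: br].
by rewrite qE.
Qed.

Lemma quadratic_mulmx n m p (q : 'rV[R]_n -> 'rV[R]_m) (L : 'M[R]_(m, p)) :
  quadratic q -> quadratic (fun v => q v *m L).
Proof.
move=> [b [bl br] qE]; exists (fun u v => b u v *m L) => [|v]; last by rewrite qE.
by split=> v a u w; rewrite scalemxAl -mulmxDl; [rewrite bl|rewrite br].
Qed.

Lemma quadraticD n p (q r : 'rV[R]_n -> 'rV[R]_p) :
  quadratic q -> quadratic r -> quadratic (fun v => q v + r v).
Proof.
move=> [b [bl br] qE] [c [cl cr] rE].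
exists (fun u v => b u v + c u v) => [|v]; last by rewrite qE rE.
by split=> v a u w; rewrite scalerDr addrACA; [rewrite bl cl|rewrite br cr].
Qed.

Lemma quadraticN n p (q : 'rV[R]_n -> 'rV[R]_p) :
  quadratic q -> quadratic (fun v => - q v).
Proof.
move=> [b [bl br] qE]; exists (fun u v => - b u v) => [|v]; last by rewrite qE.
by split=> v a u w; rewrite scalerN -opprD; [rewrite bl|rewrite br].
Qed.

Lemma quadratic_prod n p (a : 'cV[R]_n) (B : 'M[R]_(n, p)) :
  quadratic (fun v => (v *m a) 0 0 *: (v *m B)).
Proof.
exists (fun u v => (u *m a) 0 0 *: (v *m B)) => //; split=> v c u w.
  by rewrite mulmxDl -scalemxAl !mxE scalerDl scalerA.
by rewrite mulmxDl -scalemxAl scalerDr !scalerA mulrC.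
Qed.

Lemma quadratic_quad_part n p (f : 'rV[R]_n -> 'rV[R]_p) :
  map_germ f -> quadratic (quad_part f).
Proof.
move=> gf; exists (fun u v => 2^-1 *: hess f u v) => //; split=> v a u w.
  by rewrite (hess_linearl v gf) scalerDr !scalerA mulrC.
by rewrite (hess_linearr v gf) scalerDr !scalerA mulrC.
Qed.

Lemma jet2_jet n p (f : 'rV[R]_n -> 'rV[R]_p) :
  map_germ f -> jet2 f = jet (jacobian f 0) (quad_part f).
Proof. by move=> gf; apply/funext => v; exact: jet2E. Qed.

(** Evaluating at [v] and at [- v] separates the even part from the odd one. *)
Lemma jet_inj n p (A A' : 'M[R]_(n, p)) q q' :
  quadratic q -> quadratic q' -> jet A q = jet A' q' -> A = A' /\ q = q'.
Proof.
move=> Qq Qq' E.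
have qq' v : q v = q' v.
  have /rowP E1 := congr1 (@^~ v) E; have /rowP E2 := congr1 (@^~ (- 1 *: v)) E.
  apply/rowP => i; move: (E1 i) (E2 i); rewrite /jet.
  rewrite (quadraticZ _ _ Qq) (quadraticZ _ _ Qq') sqrrN expr1n !scale1r.
  by rewrite !scaleN1r !mulNmx !mxE; lra.
split; last exact/funext.
apply/row_matrixP => i; have := congr1 (@^~ 'e_i) E.
by rewrite /jet qq' !rowE => /addIr.
Qed.

End quadratic.

(** * Jets of explicit germs *)

Section concrete.
Context {R : realType}.

Lemma Ck_id k n (U : set 'rV[R]_n) : Ck k U (fun x : 'rV[R]_n => x).
Proof.
case: k => [x _|k]; first exact: cvg_id.
split=> [x _|v]; first exact: (@ex_diff _ _ _ _ _ _ _ (is_diff_id x)).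
suff -> : 'D_v (fun x : 'rV[R]_n => x) = (fun=> v) by exact: Ck_cst.
by apply/funext => x; exact: derive_id.
Qed.

Lemma Ck_mulmx k n p (U : set 'rV[R]_n) (A : 'M[R]_(n, p)) :
  open U -> Ck k U (fun x : 'rV[R]_n => x *m A).
Proof.
move=> oU; apply/Ck_coord => // j.
apply: (Ck_ext (f := fun x : 'rV[R]_n => \sum_i x 0 i * A i j)) => //.
  by move=> x _; rewrite mxE.
apply: Ck_sum => // i; apply: CkM => //; last exact: Ck_cst.
by move: i; apply/Ck_coord => //; exact: Ck_id.
Qed.

Lemma CkZ k n p (U : set 'rV[R]_n) (a : 'rV[R]_n -> R) (G : 'rV[R]_n -> 'rV[R]_p) :
  open U -> Ck k U a -> Ck k U G -> Ck k U (fun x => a x *: G x).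
Proof.
move=> oU Ca CG; apply/Ck_coord => // j.
apply: (Ck_ext (f := fun x : 'rV[R]_n => a x * G x 0 j)) => //.
  by move=> x _; rewrite mxE.
by apply: CkM => //; move: j; exact/Ck_coord.
Qed.

Lemma differentiable_mulmx n p (A : 'M[R]_(n, p)) x :
  differentiable (fun x : 'rV[R]_n => x *m A) x.
Proof. by have [+ _] := Ck_mulmx 1 A (@openT 'rV[R]_n); apply. Qed.

Lemma derive_linear n p (A : 'M[R]_(n, p)) x v :
  'D_v (fun x : 'rV[R]_n => x *m A) x = v *m A.
Proof.
rewrite deriveE; last exact: differentiable_mulmx.
rewrite (@diff_lin _ _ _ (mulmxr A)) // => y.
exact/differentiable_continuous/differentiable_mulmx.
Qed.

Definition lform n (a : 'cV[R]_n) (x : 'rV[R]_n) : R := (x *m a) 0 0.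

Lemma lformD n (a : 'cV[R]_n) u v : lform a (u + v) = lform a u + lform a v.
Proof. by rewrite /lform mulmxDl mxE. Qed.

Lemma lformBl n (a b : 'cV[R]_n) v : lform (a - b) v = lform a v - lform b v.
Proof. by rewrite /lform mulmxBr !mxE. Qed.

Lemma lformZl n c (a : 'cV[R]_n) v : lform (c *: a) v = c * lform a v.
Proof. by rewrite /lform -scalemxAr mxE. Qed.

Lemma lform_delta n (i : 'I_n) v : lform (delta_mx i 0) v = v 0 i :> R.
Proof. by rewrite /lform -colE mxE. Qed.

Lemma Ck_lform k n (U : set 'rV[R]_n) (a : 'cV[R]_n) : open U -> Ck k U (lform a).
Proof.
by move=> oU; exact: ((Ck_coord k (fun x => x *m a) oU).1 (Ck_mulmx k a oU) 0).
Qed.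

Lemma differentiable_lform n (a : 'cV[R]_n) x : differentiable (lform a) x.
Proof. by have [+ _] := Ck_lform 1 a (@openT 'rV[R]_n); apply. Qed.

Lemma derive_lform n (a : 'cV[R]_n) x v : 'D_v (lform a) x = lform a v.
Proof.
have d := diff_derivable (v := v) (differentiable_mulmx a x).
by rewrite /lform -(derive_linear a x v) (derive_mx d) mxE.
Qed.

Lemma differentiable_exp_lform n (b : 'cV[R]_n) x :
  differentiable (fun x => expR (lform b x)) x.
Proof.
apply: (@differentiable_comp _ _ _ _ (lform b) (@expR R)).
  exact: differentiable_lform.
by apply/derivable1_diffP; exact: derivable_expR.
Qed.

Lemma derive_exp_lform n (b : 'cV[R]_n) x v :
  'D_v (fun x => expR (lform b x)) x = lform b v * expR (lform b x).
Proof.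
have dexp (y : R) : derivable (@expR R) y 1 by exact: derivable_expR.
have dexp' (y : R) : differentiable (@expR R) y by exact/derivable1_diffP.
rewrite (deriveE _ (differentiable_exp_lform b x)).
rewrite (diff_comp (differentiable_lform b x) (dexp' _)) /=.
rewrite -(deriveE _ (differentiable_lform b x)) derive_lform.
by rewrite (deriv1E (dexp _)) derive1E (congr1 (@^~ _) (@derive_expR R)).
Qed.

Lemma Ck_exp_lform k n (U : set 'rV[R]_n) (b : 'cV[R]_n) :
  open U -> Ck k U (fun x => expR (lform b x)).
Proof.
move=> oU; elim: k => [x _|k IH].
  exact: differentiable_continuous (differentiable_exp_lform b x).
split=> [x _|v]; first exact: differentiable_exp_lform.
apply: (Ck_ext (f := fun x => lform b v * expR (lform b x))) => //; last first.
  by apply: CkM => //; exact: Ck_cst.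
by move=> x _; rewrite derive_exp_lform.
Qed.

Lemma map_germ_smooth n p (f : 'rV[R]_n -> 'rV[R]_p) :
  f 0 = 0 -> (forall k, Ck k setT f) -> map_germ f.
Proof.
move=> f0 Cf; split=> //; exists setT; first by split => //; exact: openT.
by move=> k; exact/is_CkE.
Qed.

Lemma jacobian_eq n p (f : 'rV[R]_n -> 'rV[R]_p) (A : 'M[R]_(n, p)) :
  map_germ f -> (forall v, 'D_v f 0 = v *m A) -> jacobian f 0 = A.
Proof.
by move=> gf DE; apply/row_matrixP => i; rewrite !rowE -derive_jacobian0 ?DE.
Qed.

(** A linear form times a germ [G] has no linear part, and its quadratic part
    only sees the Jacobian of [G]. This one computation yields the jets both of
    the polynomial normal forms, where [G] is linear, and of the exponential
    shears below. *)
Section product.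
Variables (n p : nat) (A : 'M[R]_(n, p)) (a : 'cV[R]_n).
Variable G : 'rV[R]_n -> 'rV[R]_p.
Hypothesis gG : map_germ G.

Let F x := x *m A + lform a x *: G x.

Lemma map_germ_prod : map_germ F.
Proof.
have [G0 [U oU CG]] := gG.
split; first by rewrite /F mul0mx G0 scaler0 addr0.
exists U => // k; apply/is_CkE; case: oU => oU _; apply: CkD => //.
  exact: Ck_mulmx.
by apply: CkZ => //; [exact: Ck_lform|exact/is_CkE].
Qed.

Lemma derive_prod x v : differentiable G x ->
  'D_v F x = v *m A + (lform a v *: G x + lform a x *: 'D_v G x).
Proof.
move=> dG; have da := diff_derivable (v := v) (differentiable_lform a x).
have [d1 d2] := derive_scale da (diff_derivable (v := v) dG).
rewrite (deriveD (diff_derivable (differentiable_mulmx A x)) d1).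
by rewrite d2 derive_linear derive_lform.
Qed.

Lemma lform0 : lform a 0 = 0. Proof. by rewrite /lform mul0mx mxE. Qed.

Lemma jacobian_prod : jacobian F 0 = A.
Proof.
apply: jacobian_eq => [|v]; first exact: map_germ_prod.
rewrite derive_prod; last exact: germ_diff0.
by case: gG => -> _; rewrite scaler0 lform0 scale0r !addr0.
Qed.

Lemma quad_part_prod v : quad_part F v = lform a v *: (v *m jacobian G 0).
Proof.
rewrite /quad_part /hess.
rewrite (near_eq_derive (g := fun x =>
  v *m A + (lform a v *: G x + lform a x *: 'D_v G x))); last first.
  by apply: filterS (germ_diff gG) => x dG; exact: derive_prod.
have dG := diff_derivable (v := v) (germ_diff0 gG).
have dDG := diff_derivable (v := v) (germ_derive_diff v gG).
have [d1 d2] := derive_scale (diff_derivable (v := v) (differentiable_lform a 0)) dDG.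
have d3 := derivableZ (k := lform a v) dG.
rewrite (deriveD (derivable_cst (v *m A) 0 v) (derivableD d3 d1)).
rewrite (deriveD d3 d1) d2 (deriveZ _ dG) derive_cst derive_lform lform0 scale0r.
rewrite addr0 add0r -(derive_jacobian0 _ gG) -mulr2n -[X in _ *: X]scaler_nat scalerA.
by rewrite mulVf ?scale1r// pnatr_eq0.
Qed.

End product.

End concrete.

(** * Explicit diffeomorphism germs *)

Section diffeos.
Context {R : realType}.

Lemma near0W n (P : set 'rV[R]_n) :
  (forall x, P x) -> \forall x \near (0 : 'rV[R]_n), P x.
Proof. by move=> HP; apply: filterE. Qed.

Lemma map_germ_mulmx n p (A : 'M[R]_(n, p)) : map_germ (fun x => x *m A).
Proof.
by apply: map_germ_smooth => [|k]; [rewrite mul0mx|exact/Ck_mulmx/openT].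
Qed.

Lemma jacobian_mulmx n p (A : 'M[R]_(n, p)) : jacobian (fun x => x *m A) 0 = A.
Proof.
by apply: jacobian_eq => [|v]; [exact: map_germ_mulmx|exact: derive_linear].
Qed.

Lemma quad_part_mulmx n p (A : 'M[R]_(n, p)) v : quad_part (fun x => x *m A) v = 0.
Proof.
rewrite /quad_part /hess.
rewrite (near_eq_derive (g := cst (v *m A))); last first.
  by apply: near0W => x; exact: derive_linear.
by rewrite derive_cst scaler0.
Qed.

Lemma diffeo_inv n (phi psi : 'rV[R]_n -> 'rV[R]_n) :
  map_germ phi -> map_germ psi -> cancel phi psi -> cancel psi phi ->
  diffeo_germ phi.
Proof.
move=> gphi gpsi K K'; split=> //; exists psi => //.
by split; apply: near0W.
Qed.

Lemma germ_cvg0 n p (f : 'rV[R]_n -> 'rV[R]_p) (P : set 'rV[R]_p) :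
  map_germ f -> (\forall y \near (0 : 'rV[R]_p), P y) ->
  \forall x \near (0 : 'rV[R]_n), P (f x).
Proof.
move=> gf nP; have f0 : f 0 = 0 by case: gf.
have cf : {for 0, continuous f}.
  exact/differentiable_continuous/germ_diff0.
by apply: (cf P); rewrite f0.
Qed.

Lemma diffeo_comp n (phi phi' : 'rV[R]_n -> 'rV[R]_n) :
  diffeo_germ phi -> diffeo_germ phi' -> diffeo_germ (phi' \o phi).
Proof.
move=> [gphi [psi gpsi [K1 K2]]] [gphi' [psi' gpsi' [K1' K2']]].
split; first exact: map_germ_comp.
exists (psi \o psi'); first exact: map_germ_comp.
split.
  by apply: filterS2 K1 (germ_cvg0 gphi K1') => x /= + ->.
by apply: filterS2 K2' (germ_cvg0 gpsi' K2) => x /= + ->.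
Qed.

Lemma diffeo_germE n (phi : 'rV[R]_n -> 'rV[R]_n) : diffeo_germ phi ->
  exists2 psi, diffeo_germ psi &
  (\forall x \near (0 : 'rV[R]_n), psi (phi x) = x) /\
  (\forall x \near (0 : 'rV[R]_n), phi (psi x) = x).
Proof.
move=> [gphi [psi gpsi [K1 K2]]]; exists psi => //; split => //; exists phi => //.
Qed.

Lemma diffeo_mulmx n (A : 'M[R]_n) : A \in unitmx -> diffeo_germ (fun x => x *m A).
Proof.
move=> uA; apply: (@diffeo_inv _ _ (fun x => x *m invmx A)).
- exact: map_germ_mulmx.
- exact: map_germ_mulmx.
- by move=> x; rewrite mulmxK.
- by move=> x; rewrite mulmxKV.
Qed.

(** The time-one map of the vector field [a(x) b(x) w] when [a(w) = 1] and
    [b(w) = 0]: [b] is constant along [w], so [a] is multiplied by [exp b]. *)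
Definition expshear n (a b : 'cV[R]_n) (w x : 'rV[R]_n) :=
  x *m 1%:M + lform a x *: ((expR (lform b x) - 1) *: w).

Section expshear.
Variables (n : nat) (a : 'cV[R]_n) (w : 'rV[R]_n).

Let G (b : 'cV[R]_n) x := (expR (lform b x) - 1) *: w.

Let GE b : G b = fun x => expR (lform b x) *: w + - w.
Proof. by apply/funext => x; rewrite /G scalerBl scale1r. Qed.

Let CG b k : Ck k setT (G b).
Proof.
rewrite GE; apply: CkD; [exact: openT| |exact: Ck_cst].
apply: CkZ; [exact: openT| |exact: Ck_cst].
by apply: Ck_exp_lform; exact: openT.
Qed.

Let gG b : map_germ (G b).
Proof.
apply: map_germ_smooth => [|k]; last exact: CG.
by rewrite /G lform0 expR0 subrr scale0r.
Qed.

Let JG b : jacobian (G b) 0 = b *m w.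
Proof.
apply: jacobian_eq => // v.
have dw := derivable_cst w (0 : 'rV[R]_n) v.
have [d1 d2] :=
  derive_scale (diff_derivable (v := v) (differentiable_exp_lform b 0)) dw.
rewrite GE (deriveD d1 (derivable_cst (- w) _ _)) d2 !derive_cst scaler0 !addr0.
rewrite derive_exp_lform lform0 expR0 mulr1 mulmxA.
by rewrite [v *m b]mx11_scalar mul_scalar_mx.
Qed.

Lemma map_germ_expshear b : map_germ (expshear a b w).
Proof. exact: (map_germ_prod 1%:M a (gG b)). Qed.

Lemma jacobian_expshear b : jacobian (expshear a b w) 0 = 1%:M.
Proof. exact: (jacobian_prod 1%:M a (gG b)). Qed.

Lemma quad_part_expshear b v :
  quad_part (expshear a b w) v = lform a v *: (lform b v *: w).
Proof.
rewrite /expshear (quad_part_prod _ _ (gG b)) JG mulmxA; congr (_ *: _).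
by rewrite [v *m b]mx11_scalar mul_scalar_mx.
Qed.

(** [expshear a b w] preserves [b] and multiplies [a] by [exp b]. *)
Lemma expshearK b : lform a w = 1 -> lform b w = 0 ->
  cancel (expshear a b w) (expshear a (- b) w).
Proof.
move=> aw bw x.
have lfD (c : 'cV[R]_n) (u v : 'rV[R]_n) t :
    lform c (u *m 1%:M + t *: v) = lform c u + t * lform c v.
  by rewrite /lform mulmx1 mulmxDl -scalemxAl !mxE.
set y := expshear a b w x.
have ya : lform a y = lform a x * expR (lform b x).
  by rewrite /y /expshear scalerA lfD aw; ring.
have yb : lform (- b) y = - lform b x.
  by rewrite /lform mulmxN mxE -/(lform b y) /y /expshear scalerA lfD bw mulr0 addr0.
have e0 : expR (lform b x) != 0 by rewrite gt_eqF ?expR_gt0.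
rewrite {1}/expshear ya yb expRN /y /expshear !mulmx1 -addrA !scalerA -scalerDl.
rewrite [X in X *: w](_ : _ = 0) ?scale0r ?addr0//.
by field.
Qed.

End expshear.
End diffeos.

(** * Realization of all invertible 2-jets *)

Section unipotent.
Context {R : realType}.

(** The quadratic parts realized by diffeomorphism germs tangent to the identity.
    Composition of germs adds them, hence the closure under sums. *)
Definition unipotent_jet n (q : 'rV[R]_n -> 'rV[R]_n) :=
  exists2 phi : 'rV[R]_n -> 'rV[R]_n, diffeo_germ phi &
    jacobian phi 0 = 1%:M /\ forall v, quad_part phi v = q v.

Lemma unipotent_ext n (q q' : 'rV[R]_n -> 'rV[R]_n) :
  (forall v, q v = q' v) -> unipotent_jet q -> unipotent_jet q'.
Proof. by move=> /funext ->. Qed.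

Lemma unipotent0 n : unipotent_jet (fun _ : 'rV[R]_n => 0).
Proof.
exists (fun x => x *m 1%:M); first exact/diffeo_mulmx/unitmx1.
by split=> [|v]; [exact: jacobian_mulmx|exact: quad_part_mulmx].
Qed.

Lemma unipotentD n (q q' : 'rV[R]_n -> 'rV[R]_n) :
  unipotent_jet q -> unipotent_jet q' -> unipotent_jet (fun v => q v + q' v).
Proof.
move=> [f df [Jf Qf]] [g dg [Jg Qg]]; have [gf _] := df; have [gg _] := dg.
exists (g \o f); first exact: diffeo_comp.
split=> [|v]; first by rewrite jacobian_comp// Jf Jg mulmx1.
by rewrite quad_part_comp// Jf Jg !mulmx1 Qf Qg.
Qed.

Lemma unipotent_sum n m (q : 'I_m -> 'rV[R]_n -> 'rV[R]_n) :
  (forall i, unipotent_jet (q i)) -> unipotent_jet (fun v => \sum_i q i v).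
Proof.
move=> Uq; suff H (s : seq 'I_m) : unipotent_jet (fun v => \sum_(i <- s) q i v).
  exact: H.
elim: s => [|i s IH].
  by apply: unipotent_ext (unipotent0 n) => v; rewrite big_nil.
by apply: unipotent_ext (unipotentD (Uq i) IH) => v; rewrite big_cons.
Qed.

(** Any [a] is a sum of a form equal to 1 on [w] and a multiple of a fixed such
    form [c]; the multiple can be moved to [b], which still vanishes on [w]. Both
    summands are therefore quadratic parts of exponential shears. *)
Lemma unipotent_kernel n (a b : 'cV[R]_n) (w : 'rV[R]_n) : lform b w = 0 ->
  unipotent_jet (fun v => (lform a v * lform b v) *: w).
Proof.
have unit a' b' : lform a' w = 1 -> lform b' w = 0 ->
    unipotent_jet (fun v => (lform a' v * lform b' v) *: w).
  move=> aw bw; exists (expshear a' b' w).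
    apply: (@diffeo_inv _ _ _ (expshear a' (- b') w)).
    - exact: map_germ_expshear.
    - exact: map_germ_expshear.
    - exact: expshearK.
    - rewrite -{2}(opprK b'); apply: expshearK => //.
      by rewrite /lform mulmxN mxE -/(lform _ _) bw oppr0.
  split=> [|v]; first exact: jacobian_expshear.
  by rewrite quad_part_expshear scalerA.
move=> bw; have [->|w0] := eqVneq w 0.
  by apply: unipotent_ext (unipotent0 n) => v; rewrite scaler0.
have [i wi] : exists i, w 0 i != 0.
  apply/existsP; apply: contra_neqT w0 => /existsPn w0; apply/rowP => i.
  by have := w0 i; rewrite negbK mxE => /eqP.
pose c := (w 0 i)^-1 *: delta_mx i 0 : 'cV[R]_n.
have cw : lform c w = 1.
  by rewrite lformZl lform_delta mulVf.
pose t := lform a w - 1.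
have aw : lform (a - t *: c) w = 1.
  by rewrite lformBl lformZl cw /t; ring.
apply: unipotent_ext (unipotentD (unit (a - t *: c) b aw bw)
  (unit c (t *: b) cw _)) => [v|].
  rewrite lformBl !lformZl -scalerDl.
  by congr (_ *: _); ring.
by rewrite lformZl bw mulr0.
Qed.

(** A monomial [v_i v_j e_k] falls under the previous lemma as soon as one of its
    two factors vanishes on [e_k]. The remaining one, [v_k ^ 2 e_k], has nonzero
    divergence, but for any other index [l] it equals
      v_k (v_k - v_l) (e_k + e_l) - v_k ^ 2 e_l + v_k v_l e_k + v_k v_l e_l,
    where each term has a factor vanishing on its direction. This is where
    dimension at least 2 enters. *)
Lemma unipotent_monomial n (i j k : 'I_n.+2) (c : R) :
  unipotent_jet (fun v => (c * v 0 i * v 0 j) *: delta_mx 0 k).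
Proof.
have kerj i' j' k' d : j' != k' ->
    unipotent_jet (fun v : 'rV[R]_n.+2 => (d * v 0 i' * v 0 j') *: delta_mx 0 k').
  move=> jk; pose w : 'rV[R]_n.+2 := delta_mx 0 k'.
  have bw : lform (delta_mx j' 0) w = 0 by rewrite lform_delta mxE (negbTE jk) andbF.
  apply: unipotent_ext (unipotent_kernel (d *: delta_mx i' 0) bw) => v.
  by rewrite lformZl !lform_delta.
have [jk|] := eqVneq j k; last exact: kerj.
have [ik|ik] := eqVneq i k; last first.
  by apply: unipotent_ext (kerj j i k c ik) => v; rewrite -!mulrA (mulrC (v 0 i)).
rewrite {}ik {}jk {i j}.
(* Only [v_k ^ 2 e_k] is left; [l] is an index other than [k]. *)
pose l : 'I_n.+2 := if k == 0 then 1 else 0.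
have lk : l != k by rewrite /l; case: (eqVneq k 0) => [->|]//; rewrite eq_sym.
have kl : k != l by rewrite eq_sym.
pose w : 'rV[R]_n.+2 := delta_mx 0 k + delta_mx 0 l.
have bw : lform (delta_mx k 0 - delta_mx l 0) w = 0.
  rewrite lformBl !lform_delta.
  by rewrite !mxE !eqxx (negbTE lk) (negbTE kl) /=; ring.
have U1 := unipotent_kernel (c *: delta_mx k 0) bw.
have U2 := kerj k k l (- c) kl.
have U3 := kerj k l k c lk.
have U4 := kerj l k l c kl.
apply: unipotent_ext (unipotentD (unipotentD U1 U2) (unipotentD U3 U4)) => v.
rewrite lformBl lformZl !lform_delta /w scalerDr.
apply/rowP => m; rewrite !mxE; ring.
Qed.

Lemma unipotent_quadratic n (q : 'rV[R]_n.+2 -> 'rV[R]_n.+2) :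
  quadratic q -> unipotent_jet q.
Proof.
move=> [b [bl br] qE].
apply: (@unipotent_ext _ (fun v => \sum_i \sum_j \sum_k
   (b 'e_i 'e_j 0 k * v 0 i * v 0 j) *: 'e_k)).
  move=> v; rewrite qE (linear_row_sum v (bl v)); apply: eq_bigr => i _.
  rewrite (linear_row_sum v (br _)) scaler_sumr; apply: eq_bigr => j _.
  rewrite [X in _ = _ *: (_ *: X)]row_sum_delta !scaler_sumr; apply: eq_bigr => k _.
  by rewrite !scalerA; congr (_ *: _); ring.
do 3![apply: unipotent_sum => ?]; exact: unipotent_monomial.
Qed.

Lemma diffeo_jet n (L : 'M[R]_n.+2) (q : 'rV[R]_n.+2 -> 'rV[R]_n.+2) :
  L \in unitmx -> quadratic q ->
  exists2 phi : 'rV[R]_n.+2 -> 'rV[R]_n.+2, diffeo_germ phi &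
    jacobian phi 0 = L /\ forall v, quad_part phi v = q v.
Proof.
move=> uL Qq.
have [f df [Jf Qf]] := unipotent_quadratic (quadratic_mulmx (invmx L) Qq).
have dL := diffeo_mulmx uL.
exists ((fun x => x *m L) \o f); first exact: diffeo_comp.
have [gf _] := df; have [gL _] := dL.
split=> [|v]; first by rewrite jacobian_comp// Jf jacobian_mulmx mul1mx.
by rewrite quad_part_comp// Jf mulmx1 jacobian_mulmx quad_part_mulmx addr0 Qf mulmxKV.
Qed.

End unipotent.

(** * Orbits as equivalence classes *)

Section orbits.
Context {R : realType}.

Lemma A2_orbit_refl n p (f : 'rV[R]_n -> 'rV[R]_p) :
  map_germ f -> A2_orbit (jet2 f) (jet2 f).
Proof.
move=> gf; have d m : diffeo_germ (fun x : 'rV[R]_m => x).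
  have := diffeo_mulmx (unitmx1 R m); congr diffeo_germ.
  by apply/funext => x; rewrite mulmx1.
by exists f, (fun x => x), (fun x => x).
Qed.

Lemma jet2_near n p (f g : 'rV[R]_n -> 'rV[R]_p) :
  (\forall x \near (0 : 'rV[R]_n), f x = g x) -> jet2 f = jet2 g.
Proof.
move=> /near_join fg; apply/funext => v; rewrite /jet2.
have D i : \forall x \near (0 : 'rV[R]_n), 'D_('e_i) f x = 'D_('e_i) g x.
  by apply: filterS fg => x; exact: near_eq_derive.
have D1 : (fun i => 'D_('e_i) f 0) = (fun i => 'D_('e_i) g 0).
  by apply/funext => i; exact: (nbhs_singleton (D i)).
have D2 : (fun i k => 'D_('e_i) (fun x => 'D_('e_k) f x) 0) =
          (fun i k => 'D_('e_i) (fun x => 'D_('e_k) g x) 0).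
  by apply/funext => i; apply/funext => k; exact: near_eq_derive (D k).
pose F (d : 'I_n -> 'rV[R]_p) (h : 'I_n -> 'I_n -> 'rV[R]_p) :=
  \sum_i v 0 i *: d i + 2^-1 *: \sum_i \sum_k (v 0 i * v 0 k) *: h i k.
exact: (congr2 F D1 D2).
Qed.

(** The inverse coordinate changes bring [Phi \o f \o psi] back to a map that has
    the same germ as [f]. *)
Lemma A2_orbit_sym n p (j j' : 'rV[R]_n -> 'rV[R]_p) :
  A2_orbit j j' -> A2_orbit j' j.
Proof.
move=> [f [psi [Phi [gf <- dpsi dPhi <-]]]].
have [psi' dpsi' [_ K]] := diffeo_germE dpsi.
have [Phi' dPhi' [K' _]] := diffeo_germE dPhi.
exists (Phi \o f \o psi), psi', Phi'.
have [gpsi _] := dpsi; have [gPhi _] := dPhi; have [gpsi' _] := dpsi'.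
split=> [| | | |].
- by apply: map_germ_comp gpsi _; exact: map_germ_comp.
- exact: erefl.
- exact: dpsi'.
- exact: dPhi'.
have K'' := germ_cvg0 gf K'.
by apply: jet2_near; apply: filterS2 K K'' => x /= -> ->.
Qed.

(** The action of coordinate changes is well defined on 2-jets; transitivity
    needs it because an orbit only remembers the jet of a representative. *)
Lemma jet2_comp_eq n p m q (f g : 'rV[R]_n -> 'rV[R]_p)
    (psi : 'rV[R]_m -> 'rV[R]_n) (Phi : 'rV[R]_p -> 'rV[R]_q) :
  map_germ f -> map_germ g -> map_germ psi -> map_germ Phi ->
  jet2 f = jet2 g -> jet2 (Phi \o f \o psi) = jet2 (Phi \o g \o psi).
Proof.
move=> gf gg gpsi gPhi.
have gPf := map_germ_comp gf gPhi; have gPg := map_germ_comp gg gPhi.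
rewrite (jet2_jet gf) (jet2_jet gg) (jet2_jet (map_germ_comp gpsi gPf)).
rewrite (jet2_jet (map_germ_comp gpsi gPg)).
move=> /(jet_inj (quadratic_quad_part gf) (quadratic_quad_part gg))[J Q].
rewrite (jacobian_comp gpsi gPf) (jacobian_comp gpsi gPg).
have -> : quad_part (Phi \o f \o psi) = quad_part (Phi \o g \o psi).
  apply/funext => v; rewrite (quad_part_comp v gpsi gPf) (quad_part_comp v gpsi gPg).
  rewrite (quad_part_comp _ gf gPhi) (quad_part_comp _ gg gPhi).
  by rewrite (jacobian_comp gf gPhi) (jacobian_comp gg gPhi) J Q.
by rewrite (jacobian_comp gf gPhi) (jacobian_comp gg gPhi) J.
Qed.

Lemma A2_orbit_trans n p (j j' j'' : 'rV[R]_n -> 'rV[R]_p) :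
  A2_orbit j j' -> A2_orbit j' j'' -> A2_orbit j j''.
Proof.
move=> [f [psi [Phi [gf <- dpsi dPhi <-]]]].
move=> [g [psi' [Phi' [gg Eg dpsi' dPhi' <-]]]].
exists f, (psi \o psi'), (Phi' \o Phi).
have [gpsi _] := dpsi; have [gPhi _] := dPhi.
have [gpsi' _] := dpsi'; have [gPhi' _] := dPhi'.
have gPfp := map_germ_comp gpsi (map_germ_comp gf gPhi).
have dpp := diffeo_comp dpsi' dpsi; have dPP := diffeo_comp dPhi dPhi'.
have E : (Phi' \o Phi) \o f \o (psi \o psi') = Phi' \o (Phi \o f \o psi) \o psi'.
  by [].
have H := jet2_comp_eq gPfp gg gpsi' gPhi' (esym Eg).
split.
- exact: gf.
- exact: erefl.
- exact: dpp.
- exact: dPP.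
- rewrite E H; exact: erefl.
Qed.

Lemma A2_orbit_eq n p (j j' : 'rV[R]_n -> 'rV[R]_p) :
  A2_orbit j j' -> A2_orbit j = A2_orbit j'.
Proof.
move=> jj'; apply/seteqP; split=> k.
  exact/A2_orbit_trans/A2_orbit_sym.
exact: A2_orbit_trans.
Qed.

(** From here on, coordinate changes can be prescribed by matrices and quadratic
    maps alone. *)
Lemma A2_orbit_step n p (A : 'M[R]_(n.+2, p.+2)) q
    (M : 'M[R]_n.+2) r (L : 'M[R]_p.+2) s f :
  map_germ f -> jet2 f = jet A q -> quadratic q ->
  M \in unitmx -> L \in unitmx -> quadratic r -> quadratic s ->
  A2_orbit (jet A q) (jet (M *m A *m L)
    (fun v => (r v *m A + q (v *m M)) *m L + s (v *m M *m A))).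
Proof.
move=> gf Ef Qq uM uL Qr Qs.
have [psi dpsi [Jpsi Qpsi]] := diffeo_jet uM Qr.
have [Phi dPhi [JPhi QPhi]] := diffeo_jet uL Qs.
have [gpsi _] := dpsi; have [gPhi _] := dPhi.
have gPf := map_germ_comp gf gPhi.
exists f, psi, Phi; split; [exact: gf|exact: Ef|exact: dpsi|exact: dPhi|].
move: Ef; rewrite (jet2_jet gf) (jet2_jet (map_germ_comp gpsi gPf)).
move=> /(jet_inj (quadratic_quad_part gf) Qq)[JA QA].
rewrite (jacobian_comp gpsi gPf) (jacobian_comp gf gPhi) JA Jpsi JPhi mulmxA.
apply/funext => v; rewrite /jet (quad_part_comp v gpsi gPf).
rewrite (quad_part_comp _ gf gPhi) (jacobian_comp gf gPhi) JA JPhi Jpsi Qpsi QPhi QA.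
by rewrite !mulmxDl !mulmxA !addrA.
Qed.

Lemma jacobian_diffeo n (phi : 'rV[R]_n -> 'rV[R]_n) :
  diffeo_germ phi -> jacobian phi 0 \in unitmx.
Proof.
move=> [gphi [psi gpsi [K _]]]; have gpp := map_germ_comp gphi gpsi.
have g1 := map_germ_mulmx (1%:M : 'M[R]_n).
have : jet2 (psi \o phi) = jet2 (fun x => x *m 1%:M).
  by apply: jet2_near; apply: filterS K => x /= ->; rewrite mulmx1.
rewrite (jet2_jet gpp) (jet2_jet g1).
move=> /(jet_inj (quadratic_quad_part gpp) (quadratic_quad_part g1))[+ _].
rewrite (jacobian_comp gphi gpsi) (jacobian_mulmx (1%:M : 'M[R]_n)).
move=> /mulmx1_unit [uphi _]; exact: uphi.
Qed.

Lemma A2_orbit_inv n p (A A' : 'M[R]_(n, p)) q q' :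
  quadratic q -> quadratic q' -> A2_orbit (jet A q) (jet A' q') ->
  exists (M : 'M[R]_n) (L : 'M[R]_p) r s,
  [/\ M \in unitmx, L \in unitmx, A' = M *m A *m L &
     quadratic r /\ quadratic s /\
     forall v, q' v = (r v *m A + q (v *m M)) *m L + s (v *m M *m A)].
Proof.
move=> Qq Qq' [f [psi [Phi [gf Ef dpsi dPhi E]]]].
have [gpsi _] := dpsi; have [gPhi _] := dPhi.
have gPf := map_germ_comp gf gPhi.
have gPfp := map_germ_comp gpsi gPf.
exists (jacobian psi 0), (jacobian Phi 0), (quad_part psi), (quad_part Phi).
move: Ef E; rewrite (jet2_jet gf) (jet2_jet gPfp).
move=> /(jet_inj (quadratic_quad_part gf) Qq)[JA QA].
move=> /(jet_inj (quadratic_quad_part gPfp) Qq')[JA' QA'].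
split; [exact: jacobian_diffeo|exact: jacobian_diffeo| |].
  by rewrite -JA' (jacobian_comp gpsi gPf) (jacobian_comp gf gPhi) JA mulmxA.
split; first exact: quadratic_quad_part; split; first exact: quadratic_quad_part.
move=> v; rewrite -QA' (quad_part_comp v gpsi gPf) (quad_part_comp _ gf gPhi).
by rewrite (jacobian_comp gf gPhi) JA QA mulmxDl !mulmxA addrA.
Qed.

End orbits.

(** * The jets (x, y, z (x, y, z) C) *)

Lemma linear_mx (K : fieldType) n p (g : 'rV[K]_n -> 'rV[K]_p) :
  linear g -> exists N, forall v, g v = v *m N.
Proof.
move=> gl; pose G : {linear 'rV[K]_n -> 'rV[K]_p} :=
  HB.pack g (GRing.isLinear.Build _ _ _ _ _ gl).
by exists (lin1_mx G) => v; rewrite mul_rV_lin1.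
Qed.

Section normal_forms.
Context {R : realType}.

Definition proj_xy : 'M[R]_(2 + 1, 2 + 3) := block_mx 1%:M 0 0 0.
Definition coord_z : 'cV[R]_(2 + 1) := col_mx 0 1%:M.
Definition axis_z : 'rV[R]_(2 + 1) := row_mx 0 1%:M.

Definition nf_quad (C : 'M[R]_(2 + 1, 3)) (v : 'rV[R]_(2 + 1)) : 'rV[R]_(2 + 3) :=
  lform coord_z v *: (v *m (C *m row_mx 0 1%:M : 'M[R]_(2 + 1, 2 + 3))).

(** The jet (x, y, z (x, y, z) C), written with the block decompositions
    3 = 2 + 1 of the source and 5 = 2 + 3 of the target. *)
Definition nf (C : 'M[R]_(2 + 1, 3)) : 'rV[R]_(2 + 1) -> 'rV[R]_(2 + 3) :=
  jet proj_xy (nf_quad C).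

Lemma lform_coord_z (v1 : 'rV[R]_2) (v2 : 'rV[R]_1) :
  lform coord_z (row_mx v1 v2) = v2 0 0.
Proof. by rewrite /lform mul_row_col mulmx0 add0r mulmx1. Qed.

Lemma quadratic_nf C : quadratic (nf_quad C).
Proof. exact: quadratic_prod. Qed.

Lemma nf_germ C : exists2 f, map_germ f & jet2 f = nf C.
Proof.
pose B : 'M[R]_(2 + 1, 2 + 3) := C *m row_mx 0 1%:M.
have gB := map_germ_mulmx B.
have gF := map_germ_prod proj_xy coord_z gB.
exists (fun x => x *m proj_xy + lform coord_z x *: (x *m B)); first exact: gF.
rewrite (jet2_jet gF) (jacobian_prod proj_xy coord_z gB).
apply/funext => v; rewrite /nf /jet (quad_part_prod proj_xy coord_z gB v).
rewrite (jacobian_mulmx B); exact: erefl.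
Qed.

Lemma nf_step C q' M L r s :
  M \in unitmx -> L \in unitmx -> M *m proj_xy *m L = proj_xy ->
  quadratic r -> quadratic s ->
  (forall v, q' v =
     (r v *m proj_xy + nf_quad C (v *m M)) *m L + s (v *m M *m proj_xy)) ->
  A2_orbit (nf C) (jet proj_xy q').
Proof.
move=> uM uL E Qr Qs qE; have [f gf fE] := nf_germ C.
have := A2_orbit_step gf fE (quadratic_nf C) uM uL Qr Qs.
by rewrite E; move/funext: qE => <-.
Qed.

Lemma quadratic0 n p : quadratic (fun _ : 'rV[R]_n => 0 : 'rV[R]_p).
Proof. by exists (fun _ _ => 0) => //; split=> v a u w; rewrite scaler0 addr0. Qed.

Lemma unit_block_diag n m (A : 'M[R]_n) (B : 'M[R]_m) :
  A \in unitmx -> B \in unitmx -> block_mx A 0 0 B \in unitmx.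
Proof. by rewrite !unitmxE det_ublock unitrM => -> ->. Qed.

(** Linear change of the last three target coordinates. *)
Lemma nf_target_change C (G : 'M[R]_3) : G \in unitmx -> A2_orbit (nf C) (nf (C *m G)).
Proof.
move=> uG; apply: (@nf_step _ _ 1%:M (block_mx 1%:M 0 0 G) (fun=> 0) (fun=> 0)).
- exact: unitmx1.
- by apply: unit_block_diag => //; exact: unitmx1.
- by rewrite mul1mx mulmx_block !(mul0mx, mulmx0, mulmx1, addr0).
- exact: quadratic0.
- exact: quadratic0.
move=> v; rewrite mul0mx add0r addr0 mulmx1 /nf_quad -scalemxAl -!mulmxA.
rewrite mul_row_block !(mul0mx, mulmx0, mul1mx, mulmx1, add0r, addr0).
by rewrite mul_mx_row mulmx0 mulmx1.
Qed.

(** The source change (x, z) |-> (x g, z + x l / 2), with x in the plane, turns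
    z (x D + z d) into (z + x l / 2) (x g D + (x l / 2 + z) d). The cross terms in
    z and x add up to z x (g D + l d), which explains the factor 1/2; the terms
    without z depend on the first two components of the jet only and are
    removed by the target quadratic [S]. The block of [L] restores the linear
    part. *)
Lemma nf_source_change (D : 'M[R]_(2, 3)) (d : 'M[R]_(1, 3)) (g : 'M[R]_2)
    (l : 'M[R]_(2, 1)) :
  g \in unitmx -> A2_orbit (nf (col_mx D d)) (nf (col_mx (g *m D + l *m d) d)).
Proof.
move=> ug; pose l' := 2^-1 *: l.
have ll : l = l' + l' by rewrite /l' -scalerDl -[LHS]scale1r; congr (_ *: _); lra.
clearbody l'.
have ugi : invmx g \in unitmx by rewrite unitmx_inv.
pose H : 'M[R]_(3, 2 + 3) := row_mx 0 1%:M.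
pose S := (fun w : 'rV[R]_(2 + 3) => - (lform (col_mx (invmx g *m l') 0) w *:
    (w *m (col_mx (invmx g *m (g *m D + l' *m d)) 0 *m H)))).
apply: (@nf_step _ _ (block_mx g l' 0 1%:M) (block_mx (invmx g) 0 0 1%:M) (fun=> 0) S).
- by rewrite unitmxE det_ublock unitrM det1 unitr1 andbT -unitmxE.
- by apply: unit_block_diag => //; exact: unitmx1.
- by rewrite !mulmx_block !(mul0mx, mulmx0, mulmx1, addr0) mulmxV.
- exact: quadratic0.
- exact/quadraticN/quadratic_prod.
move=> v; rewrite mul0mx add0r -(hsubmxK (v : 'rV[R]_(2 + 1))).
move: (lsubmx _) (rsubmx _) => x z; rewrite {v}.
rewrite /nf_quad -/H /S !mul_row_block !(mul0mx, mulmx0, mulmx1, addr0) !lform_coord_z.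
have HL : H *m block_mx (invmx g) 0 0 1%:M = H.
  by rewrite mul_row_block !(mul0mx, mulmx0, mulmx1, mul1mx, add0r, addr0).
rewrite /lform mul_row_col mulmx0 addr0 -[_ *m block_mx _ _ _ _]scalemxAl.
rewrite -!(mulmxA _ _ (block_mx _ _ _ _)) HL !(mulmxA _ _ H) !mul_row_col.
rewrite mulmx0 addr0 !(mulmxA _ (invmx g)) !mulmxK// mulmxDr mulmxA mulmxA.
rewrite !scalemxAl -mulmxBl; congr (_ *m _).
have E1 (y : 'M[R]_1) : y *m d = y 0 0 *: d.
  by rewrite [y in LHS]mx11_scalar mul_scalar_mx.
have E2 : x *m l = x *m l' + x *m l' by rewrite {1}ll mulmxDr.
rewrite -!scalemxAl mulmxDr !mulmxA E2 !E1.
rewrite [(x *m l' + x *m l') 0 0]mxE [(x *m l' + z) 0 0]mxE.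
move: (x *m g *m D) ((x *m l') 0 0) (z 0 0) => u a t.
by apply/rowP => i; rewrite !mxE; ring.
Qed.

End normal_forms.

(** * Reduction of corank 1 jets to six canonical ones *)

Section reduction.
Context {R : realType}.

(** Writing v = pr v + z e_3 and expanding the bilinear map b of [q] gives
    q v = q (pr v) + z (v N), where N collects b(e_3, pr v), b(pr v, e_3) and
    z b(e_3, e_3). The first term is a function of v * proj_xy and is cancelled by
    a target change; the first two components of z (v N) are cancelled by a
    source change, since proj_xy reaches exactly these components. *)
Lemma A2_orbit_nf (q : 'rV[R]_(2 + 1) -> 'rV[R]_(2 + 3)) f :
  map_germ f -> jet2 f = jet proj_xy q -> quadratic q ->
  exists C, A2_orbit (jet proj_xy q) (nf C).
Proof.
move=> gf Ef Qq; have [b [bl br] qE] := Qq.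
pose pr : 'M[R]_(2 + 1) := block_mx 1%:M 0 0 0.
have gl : linear (fun v : 'rV[R]_(2 + 1) =>
    b axis_z (v *m pr) + b (v *m pr) axis_z + lform coord_z v *: b axis_z axis_z).
  move=> a u w; rewrite mulmxDl -scalemxAl br bl lformD.
  rewrite [lform _ (a *: u)](_ : _ = a * lform coord_z u); last first.
    by rewrite /lform -scalemxAl mxE.
  by apply/rowP => i; rewrite !mxE; ring.
have [N NE] := linear_mx gl.
pose C : 'M[R]_(2 + 1, 3) := N *m (col_mx 0 1%:M : 'M[R]_(2 + 3, 3)).
(* [back] embeds the plane of the first two target coordinates into the source. *)
exists C; pose back : 'M[R]_(2 + 3, 2 + 1) := block_mx 1%:M 0 0 0.
pose r := fun v : 'rV[R]_(2 + 1) => - (lform coord_z v *: (v *m (N *m back))).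
pose s := fun w : 'rV[R]_(2 + 3) => - q (w *m back).
have Qr : quadratic r by exact/quadraticN/quadratic_prod.
have Qs : quadratic s by exact/quadraticN/quadratic_comp.
suff F (v : 'rV[R]_(2 + 1)) : r v *m proj_xy + q v + s (v *m proj_xy) = nf_quad C v.
  have := A2_orbit_step gf Ef Qq (unitmx1 R _) (unitmx1 R _) Qr Qs.
  rewrite mul1mx mulmx1; congr (A2_orbit _ (jet _ _)); apply/funext => v.
  by rewrite !mulmx1; exact: F.
rewrite /r /s.
have -> : v *m proj_xy *m back = v *m pr.
  by rewrite -mulmxA /proj_xy /back /pr mulmx_block !(mul0mx, mulmx0, mulmx1, addr0).
have vE : v = v *m pr + lform coord_z v *: axis_z.
  rewrite -(hsubmxK (v : 'rV[R]_(2 + 1))); move: (lsubmx _) (rsubmx _) => x z.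
  rewrite lform_coord_z /pr mul_row_block !(mul0mx, mulmx0, mulmx1, addr0).
  rewrite scale_row_mx scaler0 add_row_mx addr0 add0r.
  by rewrite -mul_scalar_mx mulmx1 -mx11_scalar.
have qv : q v = q (v *m pr) + lform coord_z v *: (v *m N).
  rewrite {1}vE !qE (linear_fD _ _ (bl _)) !(linear_fD _ _ (br _)).
  rewrite !(linear_fZ _ _ (br _)) !(linear_fZ _ _ (bl _)) -NE.
  by apply/rowP => i; rewrite !mxE; ring.
rewrite qv mulNmx -scalemxAl.
have NC : v *m N = v *m (N *m back) *m proj_xy + v *m (C *m row_mx 0 1%:M).
  rewrite -!mulmxA -mulmxDr -mulmxDr /proj_xy /back mulmx_block mul_col_row.
  rewrite !(mul0mx, mulmx0, mulmx1, addr0) add_block_mx !addr0 !add0r.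
  by rewrite -scalar_mx_block mulmx1.
rewrite NC scalerDr /nf_quad.
set t := lform _ _; set X := v *m (N *m back) *m proj_xy; set Y := v *m (C *m _).
by apply/rowP => i; rewrite !mxE; ring.
Qed.

(** Gaussian elimination puts the Jacobian in the form [proj_xy]. *)
Lemma SigmaJ2_nf j : @SigmaJ2 R 1 3 5 j -> exists C, A2_orbit j (nf C).
Proof.
move=> [f [gf rf] <-].
have rk : \rank (jacobian f 0) = 2%N by move: rf; rewrite addn1 => -[].
set A := jacobian f 0 in rk.
have Qq := quadratic_quad_part gf.
have ucol : invmx (col_ebase A) \in unitmx by rewrite unitmx_inv col_ebase_unit.
have urow : invmx (row_ebase A) \in unitmx by rewrite unitmx_inv row_ebase_unit.
have E : invmx (col_ebase A) *m A *m invmx (row_ebase A) = proj_xy.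
  rewrite -{2}(mulmx_ebase A) rk !mulmxA mulVmx ?col_ebase_unit// mul1mx.
  by rewrite mulmxK ?row_ebase_unit//; exact: (pid_mx_block R 1 3 2).
have step := A2_orbit_step gf (jet2_jet gf) Qq ucol urow
  (quadratic0 _ _) (quadratic0 _ _).
rewrite E in step; set q' := (fun v => _) in step.
have Qq' : quadratic q'.
  apply: quadraticD (quadratic0 _ _); apply: quadratic_mulmx.
  by apply: quadraticD (quadratic_comp _ Qq); apply: quadratic_mulmx; exact: quadratic0.
have [f' [psi [Phi [gf' _ dpsi dPhi Ef']]]] := step.
have [gpsi _] := dpsi; have [gPhi _] := dPhi.
have gF := map_germ_comp gpsi (map_germ_comp gf' gPhi).
have [C HC] := A2_orbit_nf gF Ef' Qq'.
exists C; rewrite (jet2_jet gf); exact: A2_orbit_trans step HC.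
Qed.

(** [e] tells whether the last row is nonzero; [r], at most 2, is the rank of the
    two upper rows modulo the last one. *)
Definition canon (e : bool) (r : nat) : 'M[R]_(2 + 1, 3) :=
  if e then col_mx (row_mx 0 (pid_mx r) : 'M[R]_(2, 1 + 2))
                   (row_mx 1%:M 0 : 'M[R]_(1, 1 + 2))
  else col_mx (pid_mx r) 0.

(** If the last row [d] vanishes, the two upper rows undergo arbitrary row and
    column operations. Otherwise column operations turn [d] into (1, 0, 0),
    multiples of it clear the first column above, and row and column operations
    on the remaining 2 x 2 block do the rest. *)
Lemma nf_canon C : exists e r, (r <= 2)%N /\ A2_orbit (nf C) (nf (canon e r)).
Proof.
rewrite -(vsubmxK C); move: (usubmx C) (dsubmx C) => D d {C}.
have [d0|d0] := eqVneq d 0.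
  exists false, (\rank D); split; first exact: rank_leq_row.
  have ug : invmx (col_ebase D) \in unitmx by rewrite unitmx_inv col_ebase_unit.
  have uG : invmx (row_ebase D) \in unitmx by rewrite unitmx_inv row_ebase_unit.
  have s1 := nf_source_change D d 0 ug.
  have s2 := nf_target_change (col_mx (invmx (col_ebase D) *m D + 0 *m d) d) uG.
  have := A2_orbit_trans s1 s2; congr (A2_orbit _ (nf _)).
  rewrite mul_col_mx d0 !mul0mx addr0; congr (col_mx _ _).
  rewrite -{2}(mulmx_ebase D) !mulmxA mulVmx ?col_ebase_unit// mul1mx.
  by rewrite mulmxK ?row_ebase_unit.
have rd : \rank d = 1%N.
  by apply/eqP; rewrite eqn_leq rank_leq_row lt0n mxrank_eq0.
pose c := col_ebase d 0 0.
have cE : col_ebase d = c%:M by exact: mx11_scalar.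
have c0 : c != 0.
  have := col_ebase_unit d; rewrite cE unitmxE det_scalar1 unitfE//.
have uG : c^-1 *: invmx (row_ebase d) \in unitmx.
  by rewrite unitmxZ ?unitfE ?invr_eq0// unitmx_inv row_ebase_unit.
set G : 'M[R]_3 := c^-1 *: invmx (row_ebase d) in uG.
have dG : d *m G = row_mx 1%:M 0 :> 'M[R]_(1, 1 + 2).
  rewrite /G -scalemxAr -{1}(mulmx_ebase d) mulmxK ?row_ebase_unit// rd cE.
  rewrite mul_scalar_mx scalerA mulVf// scale1r.
  by rewrite -[LHS]/(pid_mx 1 : 'M[R]_(1, 1 + 2)) pid_mx_row.
pose D' : 'M[R]_(2, 1 + 2) := D *m G.
(* Adding [l] times the last row (1, 0, 0) clears the first column above it. *)
pose D1 := rsubmx D'; pose l : 'M[R]_(2, 1) := - lsubmx D'.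
pose g := invmx (col_ebase D1).
have ug : g \in unitmx by rewrite unitmx_inv col_ebase_unit.
pose h : 'M[R]_(1 + 2) := block_mx 1%:M 0 0 (invmx (row_ebase D1)).
have uh : h \in unitmx.
  by apply: unit_block_diag; [exact: unitmx1|rewrite unitmx_inv row_ebase_unit].
exists true, (\rank D1); split; first exact: rank_leq_row.
have s1 := nf_target_change (col_mx D d) uG.
have s2 := nf_source_change (D *m G) (d *m G) (g *m l) ug.
rewrite -mul_col_mx in s2.
have s3 := nf_target_change (col_mx (g *m (D *m G) + g *m l *m (d *m G)) (d *m G)) uh.
have := A2_orbit_trans (A2_orbit_trans s1 s2) s3; congr (A2_orbit _ (nf _)).
have R1 : (row_mx 1%:M 0 : 'M[R]_(1, 1 + 2)) *m h = row_mx 1%:M 0.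
  by rewrite /h mul_row_block !(mul0mx, mulmx0, mulmx1, addr0).
have R2 : (g *m (D' + l *m row_mx 1%:M 0)) *m h = row_mx 0 (pid_mx (\rank D1)).
  rewrite -(hsubmxK D') -/D1 mul_mx_row mulmx1 mulmx0 add_row_mx addr0.
  rewrite /l subrr mul_mx_row mulmx0 /h mul_row_block.
  rewrite !(mul0mx, mulmx0, addr0, add0r); congr row_mx.
  rewrite /g -{2}(mulmx_ebase D1) !mulmxA mulVmx ?col_ebase_unit// mul1mx.
  by rewrite mulmxK ?row_ebase_unit.
rewrite mul_col_mx /canon; congr (col_mx _ _); last by rewrite dG; exact: R1.
by rewrite dG -[g *m l *m _]mulmxA -mulmxDr; exact: R2.
Qed.

End reduction.

(** * The intrinsic second derivative *)

Section invariants.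
Context {R : realType}.
Implicit Types C D : 'M[R]_(2 + 1, 3).

(** The matrix that doubles the last coordinate: z (v C) has polar form
    u |-> u C + z(u) e_3 C in the direction e_3, that is [u *m (double_z *m C)]. *)
Definition double_z : 'M[R]_(2 + 1) := block_mx 1%:M 0 0 2%:M.

Lemma lform_axis_z : lform coord_z axis_z = 1 :> R.
Proof. by rewrite lform_coord_z mxE. Qed.

Lemma mulmx_double_z (u : 'rV[R]_(2 + 1)) :
  u *m double_z = u + lform coord_z u *: axis_z.
Proof.
rewrite -(hsubmxK u); move: (lsubmx _) (rsubmx _) => x z.
rewrite lform_coord_z /double_z /axis_z mul_row_block !(mulmx0, mulmx1, addr0, add0r).
rewrite scale_row_mx scaler0 add_row_mx addr0; congr row_mx.
by apply/rowP => i; rewrite (ord1 i) mul_mx_scalar !mxE ?eqxx /= ?mulr1n ?mulr1; ring.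
Qed.

Lemma polar_nf C (u : 'rV[R]_(2 + 1)) a :
  nf_quad C (u + a *: axis_z) - nf_quad C u - nf_quad C (a *: axis_z) =
  a *: (u *m (double_z *m C) *m row_mx 0 1%:M).
Proof.
rewrite /nf_quad (mulmxA u double_z) mulmx_double_z lformD.
have -> : lform coord_z (a *: axis_z) = a.
  by rewrite /lform -scalemxAl mxE -/(lform _ _) lform_axis_z mulr1.
rewrite !mulmxDl -!scalemxAl !mulmxA; move: (lform _ _) => t.
by apply/rowP => i; rewrite !mxE; ring.
Qed.

(** The kernel of [proj_xy] is spanned by e_3, so [M] preserves that line, with
    eigenvalue [a]. Polarize the equation of quadratic parts in the direction
    e_3 and project to the last three coordinates (the matrix [K]): the source
    term r lands in the image of [proj_xy *m L], which [K] kills, and the target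
    term s is unchanged by adding a multiple of e_3 to its argument, hence drops
    out of the polarization. *)
Lemma A2_orbit_nf_inv C D : A2_orbit (nf D) (nf C) ->
  exists (a : R) (M : 'M[R]_(2 + 1)) (G : 'M[R]_3),
  [/\ axis_z *m M = a *: axis_z & double_z *m C = a *: (M *m double_z *m D *m G)].
Proof.
move=> /(A2_orbit_inv (quadratic_nf D) (quadratic_nf C)).
move=> [M [L [r [s [uM uL E [Qr [Qs qE]]]]]]].
pose K : 'M[R]_(2 + 3, 3) := col_mx 0 1%:M.
pose H : 'M[R]_(3, 2 + 3) := row_mx 0 1%:M.
have PK : proj_xy *m K = 0 :> 'M[R]_(2 + 1, 3).
  by rewrite /proj_xy /K mul_block_col !(mul0mx, mulmx0, addr0) col_mx0.
have PLK : proj_xy *m L *m K = 0.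
  have -> : proj_xy *m L = invmx M *m proj_xy by rewrite {2}E -mulmxA mulKmx.
  by rewrite -mulmxA PK mulmx0.
have zP : axis_z *m proj_xy = 0 :> 'rV[R]_(2 + 3).
  by rewrite /axis_z /proj_xy mul_row_block !(mul0mx, mulmx0, addr0) row_mx0.
have MP : M *m proj_xy = proj_xy *m invmx L by rewrite [in RHS]E mulmxK.
have zMP : axis_z *m M *m proj_xy = 0 by rewrite -mulmxA MP mulmxA zP mul0mx.
have [a aE] : exists a, axis_z *m M = a *: axis_z.
  rewrite -(hsubmxK (axis_z *m M)); exists (rsubmx (axis_z *m M) 0 0).
  have : row_mx (lsubmx (axis_z *m M)) (rsubmx (axis_z *m M)) *m proj_xy = 0.
    by rewrite hsubmxK.
  rewrite /proj_xy mul_row_block !(mul0mx, mulmx0, addr0) mulmx1.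
  rewrite -[X in _ = X]row_mx0 => /eq_row_mx[-> _].
  rewrite {2}/axis_z scale_row_mx scaler0; congr row_mx.
  by rewrite -mul_scalar_mx mulmx1 -mx11_scalar.
exists a, M, (H *m L *m K); split=> //.
have s0 : s 0 = 0.
  by have := quadraticZ 0 0 Qs; rewrite scale0r expr0n scale0r.
have HK : H *m K = 1%:M by rewrite /H /K mul_row_col mul0mx add0r mulmx1.
have Q v : nf_quad C v *m K =
    nf_quad D (v *m M) *m (L *m K) + s (v *m M *m proj_xy) *m K.
  have rPLK : r v *m proj_xy *m L *m K = 0.
    by rewrite -!mulmxA (mulmxA proj_xy) PLK mulmx0.
  by rewrite qE !mulmxDl rPLK add0r -[nf_quad _ _ *m L *m K]mulmxA.
have polC (v : 'rV[R]_(2 + 1)) : (v *m (double_z *m C)) =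
    (nf_quad C (v + 1 *: axis_z) - nf_quad C v - nf_quad C (1 *: axis_z)) *m K.
  by rewrite polar_nf scale1r -/H -mulmxA HK mulmx1.
have key (v : 'rV[R]_(2 + 1)) : v *m (double_z *m C) =
    v *m (a *: (M *m double_z *m D *m (H *m L *m K))).
  rewrite polC !mulmxBl !Q !scale1r mulmxDl (mulmxDl (v *m M)) zMP addr0.
  rewrite s0 mul0mx addr0.
  have := congr1 (mulmx^~ (L *m K)) (polar_nf D (v *m M) a).
  rewrite /= !mulmxBl aE -/H -!scalemxAl -scalemxAr !mulmxA => <-.
  by rewrite opprD addrACA subrr addr0.
by apply/row_matrixP => i; rewrite !rowE key.
Qed.

End invariants.

(** * The six orbits *)

Section final.
Context {R : realType}.
Implicit Types C D : 'M[R]_(2 + 1, 3).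

Lemma mul_axis_z C : axis_z *m C = dsubmx C.
Proof.
by rewrite -{1}(vsubmxK C) /axis_z mul_row_col mul0mx mul1mx add0r.
Qed.

Lemma A2_orbit_nf_le C D : A2_orbit (nf D) (nf C) ->
  (\rank C <= \rank D)%N /\ (dsubmx D = 0 -> dsubmx C = 0).
Proof.
move=> /A2_orbit_nf_inv[a [M [G [zM E]]]].
have udouble : double_z \in @unitmx R _.
  apply: unit_block_diag; first exact: unitmx1.
  by rewrite unitmxE det_scalar1 unitfE pnatr_eq0.
have CE : C = invmx double_z *m (a *: M *m double_z *m D *m G).
  by rewrite -!scalemxAl -E mulKmx.
split.
  rewrite CE (leq_trans (mxrankM_maxr _ _))// (leq_trans (mxrankM_maxl _ _))//.
  exact: mxrankM_maxr.
have zd : axis_z *m double_z = 2 *: axis_z :> 'rV[R]_(2 + 1).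
  by rewrite mulmx_double_z lform_axis_z -{1}(scale1r axis_z) -scalerDl.
move=> D0; have : axis_z *m (double_z *m C) = 0.
  rewrite E -scalemxAr !mulmxA zM -!scalemxAl zd -!scalemxAl mul_axis_z D0.
  by rewrite mul0mx !scaler0.
rewrite mulmxA zd -scalemxAl mul_axis_z => /eqP.
by rewrite scaler_eq0 pnatr_eq0 /= => /eqP.
Qed.

Lemma rank_canon e r : (r <= 2)%N -> \rank (canon e r : 'M[R]_(2 + 1, 3)) = (e + r)%N.
Proof.
move=> r2; rewrite /canon; case: e.
  have -> : \rank (col_mx (row_mx 0 (pid_mx r)) (row_mx 1%:M 0) : 'M[R]_(2 + 1, 1 + 2))
     = \rank (block_mx 1%:M 0 0 (pid_mx r) : 'M[R]_(1 + 2, 1 + 2)).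
    by rewrite block_mxEv -!addsmxE addsmxC.
  by rewrite rank_diag_block_mx mxrank1 rank_pid_mx.
by rewrite rank_col_mx0 add0n rank_pid_mx// (leq_trans r2).
Qed.

Lemma dsubmx_canon e r : (dsubmx (canon e r : 'M[R]_(2 + 1, 3)) == 0) = ~~ e.
Proof.
rewrite /canon; case: e; rewrite col_mxKd ?eqxx//.
apply/negbTE/eqP => /(congr1 (fun A : 'M[R]_(1, 1 + 2) => lsubmx A 0 0)).
by rewrite row_mxKl !mxE => /eqP; rewrite oner_eq0.
Qed.

Lemma nf_canon_inj e r e' r' : (r <= 2)%N -> (r' <= 2)%N ->
  A2_orbit (nf (canon e r)) = A2_orbit (nf (canon e' r') : _ -> 'rV[R]_(2 + 3)) ->
  e = e' /\ r = r'.
Proof.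
move=> r2 r2' E; have refl C : A2_orbit (nf C) (nf C).
  by have [f gf <-] := nf_germ C; exact: A2_orbit_refl.
have o1 : A2_orbit (nf (canon e r)) (nf (canon e' r') : _ -> 'rV[R]_(2 + 3)).
  by rewrite E; exact: refl.
have [rk1 d1] := A2_orbit_nf_le o1.
have [rk2 d2] := A2_orbit_nf_le (A2_orbit_sym o1).
have ee' : e = e'.
  apply: negb_inj; rewrite -(dsubmx_canon e r) -(dsubmx_canon e' r').
  by apply/eqP/eqP => [/d1|/d2].
split=> //; apply/eqP; rewrite -(eqn_add2l e) {2}ee' -!rank_canon//.
by rewrite eqn_leq rk1 rk2.
Qed.

Lemma nfE C (v : 'rV[R]_(2 + 1)) :
  nf C v = row_mx (lsubmx v) (lform coord_z v *: (v *m C)).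
Proof.
rewrite /nf /jet /nf_quad mulmxA mul_mx_row mulmx0 mulmx1 scale_row_mx scaler0.
rewrite -{1}(hsubmxK v) /proj_xy mul_row_block !(mulmx0, mulmx1, addr0).
by rewrite add_row_mx addr0 add0r.
Qed.

Lemma nf_map35 C : nf C = map35 (fun x y z : R => [:: x; y;
    z * (x * C 0 0 + y * C 1 0 + z * C 2%:R 0);
    z * (x * C 0 1 + y * C 1 1 + z * C 2%:R 1);
    z * (x * C 0 2%:R + y * C 1 2%:R + z * C 2%:R 2%:R)]).
Proof.
apply/funext => v; apply/rowP => i; rewrite nfE /map35 mxE [in RHS]mxE.
have zE : lform coord_z v = v 0 2%:R.
  rewrite -(hsubmxK (v : 'rV[R]_(2 + 1))) lform_coord_z hsubmxK mxE.
  by congr (v _ _); exact: val_inj.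
have vC j : (v *m C) 0 j = v 0 0 * C 0 j + v 0 1 * C 1 j + v 0 2%:R * C 2%:R j.
  rewrite mxE !big_ord_recl big_ord0 addr0 addrA.
  by congr (v _ _ * C _ _ + v _ _ * C _ _ + v _ _ * C _ _); exact: val_inj.
case: splitP => k ik.
  rewrite mxE; case: k ik => [[|[|//]] lk] ik; rewrite ik /=.
    by congr (v _ _); exact: val_inj.
  by congr (v _ _); exact: val_inj.
rewrite mxE zE vC; case: k ik => [[|[|[|//]]] lk] ik; rewrite ik /=;
  by congr (_ * (_ * C _ _ + _ * C _ _ + _ * C _ _)); exact: val_inj.
Qed.

Lemma canonE e r (i : 'I_(2 + 1)) (j : 'I_3) : canon e r i j = (if e then
   if (i < 2)%N then ((j == i.+1 :> nat) && (i < r)%N)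
   else j == 0%N :> nat
   else [&& (i < 2)%N, j == i :> nat & (i < r)%N])%:R :> R.
Proof.
rewrite /canon; case: e; rewrite mxE; case: splitP => k ik.
- rewrite ik; move: j; rewrite -[3%N]/(1 + 2)%N => j; rewrite mxE.
  case: splitP => l ->; first by rewrite (ord1 l) mxE.
  by rewrite mxE add1n eqSS eq_sym.
- rewrite (ord1 k) /=; move: j; rewrite -[3%N]/(1 + 2)%N => j; rewrite mxE.
  by case: splitP => l ->; [rewrite (ord1 l) !mxE|rewrite mxE].
- by rewrite ik mxE eq_sym.
- by rewrite mxE.
Qed.

Lemma nf_canon_map35 e r : nf (canon e r) = map35 (fun x y z : R =>
  if e then [:: x; y; z ^+ 2; if (0 < r)%N then x * z else 0;
                if (1 < r)%N then y * z else 0]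
  else [:: x; y; if (0 < r)%N then x * z else 0;
                 if (1 < r)%N then y * z else 0; 0]).
Proof.
rewrite nf_map35; congr map35; apply/funext => x; apply/funext => y.
apply/funext => z; rewrite !canonE /=.
by case: e; case: (0 < r)%N; case: (1 < r)%N => /=;
  congr [:: _; _; _; _; _]; rewrite ?mulr0n ?mulr1n; ring.
Qed.

(** The canonical representative of this orbit is (x, y, z ^ 2, x z, y z), which
    differs by a cyclic permutation of the last three coordinates. *)
Lemma canon_top_orbit : A2_orbit (nf (canon true 2)) =
  A2_orbit (map35 (fun x y z : R => [:: x; y; x * z; y * z; z ^+ 2])).
Proof.
pose G : 'M[R]_(1 + 2, 2 + 1) := col_mx (row_mx 0 1%:M) (row_mx 1%:M 0).
pose G' : 'M[R]_(2 + 1, 1 + 2) := col_mx (row_mx 0 1%:M) (row_mx 1%:M 0).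
have GG' : G' *m G = 1%:M.
  rewrite /G /G' mul_col_mx !mul_row_col !(mul0mx, mul1mx, add0r, addr0).
  by rewrite -block_mxEv -scalar_mx_block.
have [_ uG] := mulmx1_unit GG'.
have := nf_target_change (canon true 2) uG.
have -> : canon true 2 = G' by rewrite /canon pid_mx_1.
rewrite GG' => /A2_orbit_eq ->; congr A2_orbit; rewrite nf_map35.
congr map35; apply/funext => x; apply/funext => y; apply/funext => z.
by rewrite !mxE /= ?mulr0n ?mulr1n; congr [:: _; _; _; _; _]; ring.
Qed.

(** The six pairs (e, r) with r <= 2 are encoded as 3 e + r. *)
Definition canon_orbit (i : nat) :=
  A2_orbit (nf (canon (3 <= i)%N (i %% 3) : 'M[R]_(2 + 1, 3))).

Lemma nf_SigmaJ2 C : SigmaJ2 1 (nf C).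
Proof.
have [f gf fE] := nf_germ C; exists f; last exact: fE.
split; first exact: gf.
move: fE; rewrite (jet2_jet gf).
move=> /(jet_inj (quadratic_quad_part gf) (quadratic_nf C))[-> _].
by rewrite /proj_xy rank_diag_block_mx mxrank1 mxrank0.
Qed.

Lemma canon_orbit_inj : {in `I_6 &, injective canon_orbit}.
Proof.
have le2 i : (i %% 3 <= 2)%N by rewrite -ltnS ltn_mod.
move=> i k /set_mem/= i6 /set_mem/= k6 /(nf_canon_inj (le2 i) (le2 k)).
by case: i i6 => [|[|[|[|[|[|//]]]]]] _; case: k k6 => [|[|[|[|[|[|//]]]]]] _ [].
Qed.

Lemma orbits_canon : [set A2_orbit j | j in @SigmaJ2 R 1 3 5] = canon_orbit @` `I_6.
Proof.
apply/seteqP; split=> [_ [j Sj <-]|_ [i _ <-]]; last first.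
  by exists (nf (canon (3 <= i)%N (i %% 3))); [exact: nf_SigmaJ2|exact: erefl].
have [C jC] := SigmaJ2_nf Sj; have [e [r [r2 Cer]]] := nf_canon C.
have E : A2_orbit j = A2_orbit (nf (canon e r)) := A2_orbit_eq (A2_orbit_trans jC Cer).
rewrite E; exists (e * 3 + r)%N.
  rewrite -ltnS in r2; case: e {Cer E} => /=.
    by rewrite mul1n -[6%N]/(3 + 3)%N ltn_add2l.
  by rewrite mul0n add0n; exact: ltn_trans r2 _.
rewrite /canon_orbit modnMDl modn_small ?ltnS//.
suff -> : (3 <= e * 3 + r)%N = e by exact: erefl.
by case: e {Cer E}; [rewrite mul1n leq_addr|rewrite mul0n add0n leqNgt ltnS r2].
Qed.

End final.

Theorem proposition3p5 (R : realType) :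
  let orbits := [set A2_orbit j | j in @SigmaJ2 R 1 3 5] in
  (orbits #= `I_6)%card /\
  orbits =
    [set A2_orbit (map35 (fun x y z : R => [:: x; y; x * z; y * z; z ^+ 2]));
         A2_orbit (map35 (fun x y z : R => [:: x; y; z ^+ 2; x * z; 0]));
         A2_orbit (map35 (fun x y z : R => [:: x; y; x * z; y * z; 0]));
         A2_orbit (map35 (fun x y z : R => [:: x; y; z ^+ 2; 0; 0]));
         A2_orbit (map35 (fun x y z : R => [:: x; y; x * z; 0; 0]));
         A2_orbit (map35 (fun x y z : R => [:: x; y; 0; 0; 0]))].
Proof.
move=> orbits.
have -> : orbits = @canon_orbit R @` `I_6 by exact: orbits_canon.
split; first by exact: (inj_card_eq (@canon_orbit_inj R)).
have o5 := @canon_top_orbit R.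
have E e r := congr1 (@A2_orbit R 3 5) (@nf_canon_map35 R e r).
apply/seteqP; split.
  move=> _ [[|[|[|[|[|[|//]]]]]] _ <-]; rewrite /canon_orbit.
  - by right; exact: (E false 0%N).
  - by left; right; exact: (E false 1%N).
  - by left; left; left; right; exact: (E false 2%N).
  - by left; left; right; exact: (E true 0%N).
  - by left; left; left; left; right; exact: (E true 1%N).
  - by left; left; left; left; left; exact: o5.
move=> X [[[[[->|->]|->]|->]|->]|->].
- by exists 5%N; [|exact: o5].
- by exists 4%N; [|exact: (E true 1%N)].
- by exists 2%N; [|exact: (E false 2%N)].
- by exists 3%N; [|exact: (E true 0%N)].
- by exists 1%N; [|exact: (E false 1%N)].
- by exists 0%N; [|exact: (E false 0%N)].
Qed.
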